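(* Consider the $N$-player game with costs $f_i$, player dynamics $\dot x_i=u_i+d_i(t)$, communication graph $\mathcal G$, and the closed-loop system given by the control law $u_i=-\frac{\partial f_i}{\partial x_i}(\mathbf y_i)-\hat z_i$ together with the consensus/observer dynamics for $y_{ij},\hat x_i,\hat z_i$ with gains depending on the parameters $\theta,\sigma>0$ (all described in the context). Suppose that: (1) for each $i\in\mathcal N$, $f_i$ is twice continuously differentiable on $\mathbb R^N$; (2) there is a constant $m>0$ such that $(\mathbf x-\mathbf z)^T(\Upsilon(\mathbf x)-\Upsilon(\mathbf z))\ge m\|\mathbf x-\mathbf z\|^2$ for all $\mathbf x,\mathbf z\in\mathbb R^N$, where $\Upsilon(\mathbf x)=\left[\frac{\partial f_1(\mathbf x)}{\partial x_1},\dots,\frac{\partial f_N(\mathbf x)}{\partial x_N}\right]^T$; (3) the communication graph $\mathcal G$ is undirected and connected; (4) for each $i\in\mathcal N$, $d_i$ is continuously differentiable and $\dot d_i(t)$ is bounded for $t\ge t_0$. Then for any positive constants $v_1,v_2$ there exist positive constants $\theta^*(v_1,v_2)$ and $\sigma^*(v_1,v_2)$ such that for each $\theta\in(\theta^*,\infty)$ and each $\sigma\in(\sigma^*,\infty)$, there exists $\bar T\ge t_0$ such that $$\|\mathcal E(t)\|\le v_2\quad\text{for all } t\ge\bar T,$$ given that $\|\mathcal E(t_0)\|\le v_1$.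
   Context: Game and dynamics. There are $N\ge 2$ players, $\mathcal N=\{1,\dots,N\}$. Player $i$ has action $x_i\in\mathbb R$, control input $u_i\in\mathbb R$, cost $f_i(\mathbf x)$ with $\mathbf x=[x_1,\dots,x_N]^T$, and dynamics $\dot x_i=u_i+d_i(t)$, $t\ge t_0$, where $d_i:[t_0,\infty)\to\mathbb R$ is an external disturbance and $t_0$ is the initial time. A Nash equilibrium is an action profile $\mathbf x^*=(x_i^*,\mathbf x_{-i}^* )$ such that for every $i\in\mathcal N$, $f_i(x_i^*,\mathbf x_{-i}^* )\le f_i(x_i,\mathbf x_{-i}^* )$ for all $x_i\in\mathbb R$, where $\mathbf x_{-i}$ collects the actions of all players other than $i$. Under hypotheses (1)-(2) the Nash equilibrium $\mathbf x^*$ exists and is unique. Communication graph. $\mathcal G$ is a weighted graph with node set $\mathcal N$ and adjacency matrix $\mathcal A=[a_{ij}]$: $a_{ij}>0$ if $(j,i)$ is an edge, $a_{ij}=0$ otherwise, and $a_{ii}=0$. It is undirected if $a_{ij}=a_{ji}$ for all $i,j$; an undirected graph is connected if there is a path between any two distinct nodes. Seeking strategy. The control law is $$u_i=-\frac{\partial f_i}{\partial x_i}(\mathbf y_i)-\hat z_i,\qquad \frac{\partial f_i}{\partial x_i}(\mathbf y_i)=\frac{\partial f_i(\mathbf x)}{\partial x_i}\Big|_{\mathbf x=\mathbf y_i},\quad \mathbf y_i=[y_{i1},\dots,y_{iN}]^T,$$ where, for $i,j\in\mathcal N$, $$\dot y_{ij}=-\theta_{ij}\Big(\sum_{k=1}^N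 a_{ik}(y_{ij}-y_{kj})+a_{ij}(y_{ij}-x_j)\Big),$$ $$\dot{\hat x}_i=u_i+\hat z_i+\bar k_{i1}(x_i-\hat x_i),\qquad \dot{\hat z}_i=\bar k_{i2}(x_i-\hat x_i),$$ with $\bar k_{i1}=\sigma k_{i1}$, $\bar k_{i2}=\sigma^2k_{i2}$, $\theta_{ij}=\theta\bar\theta_{ij}$. Here $\bar\theta_{ij},k_{i1},k_{i2}$ are fixed positive constants and $\sigma,\theta$ are positive tuning parameters. Error variables. With $z_i=d_i(t)$, set $\zeta_{i1}=x_i-\hat x_i$, $\zeta_{i2}=z_i-\hat z_i$, $\xi_i=x_i-x_i^*$, $\eta_{ij}=y_{ij}-x_j$. Let $\zeta_1,\zeta_2,\xi\in\mathbb R^N$ and $\eta\in\mathbb R^{N^2}$ be the corresponding stacked column vectors, $\zeta=[\zeta_1^T,\zeta_2^T]^T$, and $\mathcal E=[\zeta^T,\eta^T,\xi^T]^T$. $\|\cdot\|$ is the Euclidean norm. *)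

(* Defs.v *)
From HB Require Import structures.
From mathcomp Require Import all_boot all_order all_algebra.
From mathcomp Require Import all_classical all_reals all_analysis.

Set Implicit Arguments.
Unset Strict Implicit.
Unset Printing Implicit Defensive.

Import Order.TTheory GRing.Theory Num.Theory.
Import numFieldNormedType.Exports.

Local Open Scope classical_set_scope.
Local Open Scope ring_scope.

(* The library norm on matrices is the sup norm. *)
Definition norm2 (R : realType) (n : nat) (v : 'rV[R]_n) : R :=
  Num.sqrt (\sum_i v 0 i ^+ 2).

Definition partial (R : realType) (n : nat) (i : 'I_n) (g : 'rV[R]_n -> R) :
    'rV[R]_n -> R :=
  fun x => 'D_(delta_mx 0 i) g x.

(* For a differentiable g, continuity of x |-> 'd g x amounts to continuity of
   its matrix coefficients, the partial derivatives. *)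
Definition C1 (R : realType) (n : nat) (g : 'rV[R]_n -> R) : Prop :=
  (forall x, differentiable g x) /\ (forall i, continuous (partial i g)).

Definition C2 (R : realType) (n : nat) (g : 'rV[R]_n -> R) : Prop :=
  C1 g /\ forall i, C1 (partial i g).

(* l is the derivative at t of g, seen as a function on [t0, +oo[: two-sided
   for t0 < t, right derivative at t = t0. Values of g before t0 are ignored. *)
Definition deriv_from (R : realType) (t0 : R) (g : R -> R) (t l : R) : Prop :=
  (g s - g t) / (s - t) @[s --> within `[t0, +oo[ t^'] --> l.

Definition C1_bounded_from (R : realType) (t0 : R) (g : R -> R) : Prop :=
  exists g' : R -> R,
    [/\ forall t, t0 <= t -> deriv_from t0 g t (g' t),
        {within `[t0, +oo[, continuous g'}
      & exists M : R, forall t, t0 <= t -> `|g' t| <= M].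

Section Game.
Context {R : realType} {N : nat}.
Implicit Types (f : 'I_N -> 'rV[R]_N -> R) (x : 'rV[R]_N).

Definition deviate x (i : 'I_N) (a : R) : 'rV[R]_N :=
  \row_j (if j == i then a else x 0 j).

Definition nash_equilibrium f x : Prop :=
  forall i a, f i x <= f i (deviate x i a).

Definition pseudogradient f x : 'rV[R]_N := \row_i partial i (f i) x.

Definition strongly_monotone (F : 'rV[R]_N -> 'rV[R]_N) : Prop :=
  exists2 m : R, 0 < m &
    forall x z, m * norm2 (x - z) ^+ 2 <= ((x - z) *m (F x - F z)^T) 0 0.

End Game.

Section Graph.
Context {R : realType} {N : nat}.
Implicit Types A : 'M[R]_N.

Definition is_adjacency A : Prop :=
  (forall i j, 0 <= A i j) /\ (forall i, A i i = 0).

(* (j, i) is an edge iff a_ij > 0 *)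
Definition edge A : rel 'I_N := fun j i => 0 < A i j.

Definition undirected A : Prop := forall i j, A i j = A j i.

Definition connected_graph A : Prop :=
  forall i j, i != j -> connect (edge A) i j.

End Graph.

(* State of the closed loop: the actions x_i, the estimates y_ij (row i is
   the vector y_i), and the observer states of x_i and z_i. *)
Record state (R : realType) (N : nat) := State {
  act : 'rV[R]_N;
  est : 'M[R]_N;
  xhat : 'rV[R]_N;
  zhat : 'rV[R]_N
}.

Section ClosedLoop.
Context {R : realType} {N : nat}.
Variables (f : 'I_N -> 'rV[R]_N -> R) (A : 'M[R]_N) (d : 'I_N -> R -> R).
Variables (thetabar : 'M[R]_N) (k1 k2 : 'I_N -> R).
Variables (t0 theta sigma : R).

Definition control (s : state R N) (i : 'I_N) : R :=
  - partial i (f i) (row i (est s)) - zhat s 0 i.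

Definition consensus_error (s : state R N) (i j : 'I_N) : R :=
  \sum_k A i k * (est s i j - est s k j) + A i j * (est s i j - act s 0 j).

Definition closed_loop (s : R -> state R N) : Prop :=
  forall t, t0 <= t ->
  [/\ forall i, deriv_from t0 (fun r => act (s r) 0 i) t
        (control (s t) i + d i t),
      forall i j, deriv_from t0 (fun r => est (s r) i j) t
        (- (theta * thetabar i j) * consensus_error (s t) i j),
      forall i, deriv_from t0 (fun r => xhat (s r) 0 i) t
        (control (s t) i + zhat (s t) 0 i +
         sigma * k1 i * (act (s t) 0 i - xhat (s t) 0 i))
    & forall i, deriv_from t0 (fun r => zhat (s r) 0 i) t
        (sigma ^+ 2 * k2 i * (act (s t) 0 i - xhat (s t) 0 i))].

(* E = (zeta_1, zeta_2, eta, xi) at time t in state s, relative to xs *)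
Definition error (xs : 'rV[R]_N) (t : R) (s : state R N) :
    'rV[R]_((N + N) + (N * N + N)) :=
  let zeta1 := act s - xhat s in
  let zeta2 := (\row_i d i t) - zhat s in
  let eta := \matrix_(i, j) (est s i j - act s 0 j) in
  let xi := act s - xs in
  row_mx (row_mx zeta1 zeta2) (row_mx (mxvec eta) xi).

End ClosedLoop.

(* Main.v *)
(* In the scaled observer errors e1 = zeta_1, e2 = zeta_2 / sigma put
   w = e1 - (k1 / k2) e2 and chi = x - w. Then
   chi_i' = - (df_i/dx_i)(y_i) + (k1 / k2) d_i' / sigma, so that the peak of order
   sigma in zeta_2 never reaches chi, and (e1, e2), e = y - chi, p = chi - xs all
   have initial data bounded independently of theta and sigma. Their quadratic
   Lyapunov functions Ve, Vn, Vp satisfy, with Vn and Vp in a bounded region,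
     Ve' <= - a sigma Ve + O(1 / sigma^3),
     Vn' <= - c theta Vn + O(theta) Ve + O(1 / theta),
     Vp' <= - m Vp + O(Vn) + O(1 / sigma^2),
   where c > 0 is the coercivity of the pinned graph Laplacian and m the strong
   monotonicity constant. For large theta and sigma the region is invariant and
   the ultimate bound is small. Solutions exist because the partial derivatives can
   be truncated outside a box, where Picard iteration converges globally, and the
   estimate shows that the truncated solution never leaves the box. *)

Require Import Defs.
From HB Require Import structures.
From mathcomp Require Import all_boot all_order all_algebra.
From mathcomp Require Import all_classical all_reals all_analysis.
From mathcomp Require Import ring lra.
Import Order.TTheory GRing.Theory Num.Theory.
Import numFieldNormedType.Exports.
Local Open Scope classical_set_scope.
Local Open Scope ring_scope.

Set Implicit Arguments.
Unset Strict Implicit.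
Unset Printing Implicit Defensive.

(** * Calculus on a half-line *)

(** Two obstacles shape the estimates. First, theta and sigma grow independently, so no step may let
    one dominate the other: in the bound for [Vn] the factor theta of the coupling to [Ve] cancels
    against the rate c theta, whatever sigma is. Second, the constants must not be circular: the
    bound B and the Lipschitz constant L of the partial derivatives exist only on a box, and that
    box must contain the trajectory. The radii of the invariant region are therefore built from v1,
    the gains, the graph and the disturbance bound alone. B and L enter only through the drift of
    chi and through C3, and large theta and sigma make their effect small. The estimate errors are
    measured from chi and not from x because the speed of x contains sigma e2, whereas that of chi
    is bounded on the box. The main estimate is stated for any feedback that agrees with the partial
    derivatives on the box, so that it serves both the original loop and the truncated one. *)

Section OneSided.
Context {R : realType}.
Implicit Types (g G : R -> R) (t l : R).

(** In this epsilon form the two-sided derivative and [deriv_from] differ only by the condition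
    [t0 <= s], so one can be converted into the other. *)
Lemma is_derive_epsP G t l :
  is_derive t 1 G l <->
  forall e, 0 < e -> exists2 r, 0 < r &
    forall s, s != t -> `|s - t| < r -> `|l - (G s - G t) / (s - t)| < e.
Proof.
have aux : (h^-1 *: (G (h *: 1 + t) - G t) @[h --> 0^'] --> l) <->
  forall e, 0 < e -> exists2 r, 0 < r &
    forall s, s != t -> `|s - t| < r -> `|l - (G s - G t) / (s - t)| < e.
  split=> [/cvgrPdist_lt cv e e0|cv].
    have /cv := e0; rewrite near_withinE => /nbhs_ballP[r /= r0 br].
    exists r => // s st sr.
    have := br (s - t); rewrite /ball /= sub0r normrN subr_eq0 => /(_ sr st).
    by rewrite /GRing.scale /= mulr1 subrK mulrC.
  apply/cvgrPdist_lt => e e0; have [r r0 H] := cv _ e0.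
  rewrite near_withinE; apply/nbhs_ballP; exists r => //= h.
  rewrite /ball /= sub0r normrN => hr h0.
  have := H (h + t); rewrite addrK => /(_ _ hr).
  rewrite -subr_eq0 addrK => /(_ h0).
  by rewrite /GRing.scale /= mulr1 mulrC.
split=> [[dG E]|/aux H]; first by apply/aux; rewrite -E; exact: dG.
apply: DeriveDef; first by apply/cvg_ex; exists l.
exact: cvg_lim H.
Qed.

Lemma deriv_from_epsP (t0 : R) g t l : deriv_from t0 g t l <->
  forall e, 0 < e -> exists2 r, 0 < r & forall s, t0 <= s ->
    s != t -> `|s - t| < r -> `|l - (g s - g t) / (s - t)| < e.
Proof.
rewrite /deriv_from; split=> [/cvgrPdist_lt cv e e0|cv].
  have /cv := e0; rewrite !near_withinE => /nbhs_ballP[r /= r0 br].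
  exists r => // s ts st sr; apply: br => //; last by rewrite /= in_itv /= ts.
  by rewrite /ball /= distrC.
apply/cvgrPdist_lt => e e0; have [r r0 H] := cv _ e0.
rewrite !near_withinE; apply/nbhs_ballP; exists r => //= s.
rewrite /ball /= => sr st; rewrite in_itv /= andbT => ts.
by apply: H => //; rewrite distrC.
Qed.

Lemma is_derive_deriv_from (t0 : R) G t l :
  is_derive t 1 G l -> deriv_from t0 G t l.
Proof.
move/is_derive_epsP => H; apply/deriv_from_epsP => e /H[r r0 Hr].
by exists r => // s _; exact: Hr.
Qed.

(** Affine continuation to the left of t0, with slope [g' t0], turns the right derivative at t0 into
    a two-sided one. From then on the calculus of [is_derive] applies on the closed half-line. *)
Lemma deriv_from_extension (t0 : R) g (g' : R -> R) :
  (forall t, t0 <= t -> deriv_from t0 g t (g' t)) ->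
  exists G, (forall t, t0 <= t -> G t = g t) /\
            (forall t, t0 <= t -> is_derive t 1 G (g' t)).
Proof.
move=> dg.
pose G s := if t0 <= s then g s else g t0 + g' t0 * (s - t0).
have Gg t : t0 <= t -> G t = g t by rewrite /G => ->.
exists G; split=> // t tt; apply/is_derive_epsP => e e0.
have /deriv_from_epsP/(_ _ e0)[r r0 H] := dg _ tt.
move: tt; rewrite le_eqVlt => /predU1P[tt|tt].
  subst t; exists r => // s st sr; have [ts|ts] := leP t0 s.
    by rewrite !Gg//; exact: H.
  rewrite (Gg t0)// /G leNgt ts /= addrAC subrr add0r mulfK ?subr_eq0//.
  by rewrite subrr normr0.
(* The radius is cut at t - t0 so that s stays in the half-line, where G and g agree. *)
exists (Num.min r (t - t0)) => [|s st]; first by rewrite lt_min r0 subr_gt0.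
rewrite lt_min => /andP[sr]; rewrite ltr_norml => /andP[ts _].
have {}ts : t0 <= s by move: ts; rewrite opprB ltrD2r => /ltW.
by rewrite !Gg ?(ltW tt)//; apply: H.
Qed.


Lemma der_derivable G t l : is_derive t 1 G l -> derivable G t 1.
Proof. by case. Qed.

Lemma der_cont G t l : is_derive t 1 G l -> {for t, continuous G}.
Proof. by case=> dG _; exact/differentiable_continuous/derivable1_diffP. Qed.

Lemma derD g G t a b : is_derive t 1 g a -> is_derive t 1 G b ->
  is_derive t 1 (fun s => g s + G s) (a + b).
Proof. by move=> ? ?; exact: is_deriveD. Qed.

Lemma derN g t a : is_derive t 1 g a -> is_derive t 1 (fun s => - g s) (- a).
Proof. by move=> ?; exact: is_deriveN. Qed.

Lemma derB g G t a b : is_derive t 1 g a -> is_derive t 1 G b ->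
  is_derive t 1 (fun s => g s - G s) (a - b).
Proof. by move=> ? ?; exact: is_deriveB. Qed.

Lemma derM g G t a b : is_derive t 1 g a -> is_derive t 1 G b ->
  is_derive t 1 (fun s => g s * G s) (a * G t + g t * b).
Proof.
move=> ? ?; apply: (@is_derive_eq _ _ _ _ _ _ _ _ (is_deriveM _ _)).
by rewrite addrC /GRing.scale /= (mulrC a).
Qed.

Lemma derZ (c : R) g t a : is_derive t 1 g a ->
  is_derive t 1 (fun s => c * g s) (c * a).
Proof. by move=> ?; exact: is_deriveZ. Qed.

Lemma derC (c t : R) : is_derive t 1 (fun=> c) 0.
Proof. exact: is_derive_cst. Qed.

Lemma der_sum (I : finType) (h : I -> R -> R) t (a : I -> R) :
  (forall i, is_derive t 1 (h i) (a i)) ->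
  is_derive t 1 (fun s => \sum_i h i s) (\sum_i a i).
Proof.
move=> H; have -> : (fun s => \sum_i h i s) = \sum_i h i.
  by apply/funext => s; rewrite fct_sumE.
by elim/big_ind2 : _ => [|? ? ? ? ? ?|//]; [exact: derC|exact: derD].
Qed.

Lemma der_sqr g t a : is_derive t 1 g a ->
  is_derive t 1 (fun s => g s ^+ 2) (2 * g t * a).
Proof.
move=> H; have := derM H H; have -> : a * g t + g t * a = 2 * g t * a by ring.
by have -> : (fun s => g s * g s) = (fun s => g s ^+ 2).
Qed.

Lemma der_expl (a t0 t : R) :
  is_derive t 1 (fun s => expR (a * (s - t0))) (a * expR (a * (t - t0))).
Proof.
have H : is_derive t 1 (fun s => a * (s - t0)) a.
  have := derZ a (derB (is_derive_id t 1) (derC t0 t)).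
  by rewrite subr0 mulr1.
have := @is_derive1_comp R expR (fun s => a * (s - t0)) t _ _ (is_derive_expR _) H.
by rewrite mulrC.
Qed.

Lemma der_nondecreasing (W W' : R -> R) (t0 t1 : R) : t0 <= t1 ->
  (forall t, t0 <= t <= t1 -> is_derive t 1 W (W' t)) ->
  (forall t, t0 <= t <= t1 -> 0 <= W' t) -> W t0 <= W t1.
Proof.
move=> t01 dW W'ge.
have [||c ct E] := @MVT_segment R W W' t0 t1 t01.
- by move=> x; rewrite in_itv /= => /andP[x0 x1]; apply: dW; rewrite !ltW.
- apply: continuous_in_subspaceT => x; rewrite inE /= in_itv /= => xt.
  exact: der_cont (dW _ xt).
- rewrite -subr_ge0 E; move: ct; rewrite in_itv /= => /W'ge W'c.
  by rewrite mulr_ge0 // subr_ge0.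
Qed.

(* An integrating factor turns the differential inequality into monotonicity of
   [expR (a (s - t0)) (V s - b / a)]. *)
Lemma comparison (V V' : R -> R) (t0 t1 a b : R) : 0 < a -> t0 <= t1 ->
  (forall t, t0 <= t <= t1 -> is_derive t 1 V (V' t)) ->
  (forall t, t0 <= t <= t1 -> V' t <= - a * V t + b) ->
  V t1 <= expR (- a * (t1 - t0)) * (V t0 - b / a) + b / a.
Proof.
move=> a0 t01 dV V'le.
pose W s := expR (a * (s - t0)) * (V s - b / a).
pose W' s := a * expR (a * (s - t0)) * (V s - b / a) +
             expR (a * (s - t0)) * (V' s - 0).
have dW t : t0 <= t <= t1 -> is_derive t 1 W (W' t).
  by move=> tt; exact: derM (der_expl _ _ _) (derB (dV _ tt) (derC _ _)).
have W'le t : t0 <= t <= t1 -> W' t <= 0.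
  move=> /V'le H; rewrite /W' subr0 (mulrC a) -mulrA -mulrDr.
  rewrite pmulr_rle0 ?expR_gt0// mulrBr mulrCA divff ?gt_eqF//.
  by move: H; lra.
have : W t1 <= W t0.
  rewrite -lerN2; apply: (@der_nondecreasing (fun s => - W s) (fun s => - W' s)) => //.
    by move=> t /dW; exact: derN.
  by move=> t /W'le; rewrite oppr_ge0.
rewrite /W subrr mulr0 expR0 mul1r => Wle.
rewrite -lerBlDr -(ler_pM2l (expR_gt0 (a * (t1 - t0)))).
by rewrite mulrA -expRD mulNr subrr expR0 mul1r.
Qed.

End OneSided.

(** * Bootstrap in time, primitives and exponential tails *)

Section HalfLine.
Context {R : realType}.

(** Continuous induction: at the supremum [tau] of the times up to which the bound holds, the
    hypothesis improves it to a strict one, and continuity carries it past [tau]. *)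
Lemma trapped (V : R -> R) (t0 r : R) :
  (forall t, t0 <= t -> {for t, continuous V}) -> V t0 <= r ->
  (forall t1, t0 <= t1 -> (forall t, t0 <= t <= t1 -> V t <= r) -> V t1 < r) ->
  forall t, t0 <= t -> V t <= r.
Proof.
move=> cV V0 step t1 t01; rewrite leNgt; apply/negP => Vt1.
pose S := [set t | t0 <= t /\ forall s, t0 <= s <= t -> V s <= r].
have St0 : S t0 by split=> // s; rewrite -eq_le => /eqP <-.
have Sub : ubound S t1.
  move=> t [tt H]; rewrite leNgt; apply/negP => tlt.
  by move: Vt1; rewrite ltNge H// t01 ltW.
have supS : has_sup S by split; [exists t0|exists t1].
pose tau := sup S.
have t0tau : t0 <= tau by apply: ub_le_sup => //; exists t1.
have below s : t0 <= s -> s < tau -> V s <= r.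
  move=> ts st; have st0 : 0 < tau - s by rewrite subr_gt0.
  have [u [tu Hu] su] := sup_adherent st0 supS.
  by apply: Hu; rewrite ts/= ltW// -[s](subKr tau).
have Vtau : V tau <= r.
  rewrite leNgt; apply/negP => Vgt.
  have := cV _ t0tau; move=> /cvgrPdist_lt /(_ (V tau - r)).
  rewrite subr_gt0 => /(_ Vgt) /nbhs_ballP[e /= e0 He].
  have t0lt : t0 < tau.
    rewrite lt_neqAle t0tau andbT; apply: contraTneq Vgt => <-.
    by rewrite -leNgt.
  (* A time before [tau] and close to it, where the bound holds; it contradicts V > r near [tau]. *)
  pose s := Num.max t0 (tau - e / 2).
  have st : s < tau by rewrite gt_max t0lt/= gtrBl divr_gt0.
  have := He s; rewrite /ball /= ger0_norm; last by rewrite subr_ge0 ltW.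
  have -> : tau - s < e.
    rewrite ltrBlDr -ltrBlDl lt_max; apply/orP; right.
    by clear - e0; lra.
  move=> /(_ isT); rewrite ltr_norml => /andP[_].
  by rewrite ltrD2l ltrN2 ltNge below// le_max lexx.
have Vlt : V tau < r.
  apply: step => // s /andP[ts]; rewrite le_eqVlt => /predU1P[->//|st].
  exact: below.
have := cV _ t0tau; move=> /cvgrPdist_lt /(_ (r - V tau)).
rewrite subr_gt0 => /(_ Vlt) /nbhs_ballP[e /= e0 He].
have : S (tau + e / 2).
  split=> [|s /andP[ts st]]; first by rewrite ler_wpDr// divr_ge0// ltW.
  have [lt_s|ge_s] := ltP s tau; first exact: below.
  have := He s; rewrite /ball /= ler0_norm; last by rewrite subr_le0.
  rewrite opprB ltrBlDl.
  have -> : s < tau + e.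
    by clear - e0 st; lra.
  move=> /(_ isT); rewrite ltr_norml ltrNl opprB => /andP[+ _].
  by rewrite ltrD2r => /ltW.
move=> /(ub_le_sup (ex_intro _ _ Sub)); rewrite -/tau leNgt ltrDl divr_gt0//.
Qed.

Lemma primitive (h : R -> R) (t0 : R) : continuous h ->
  exists H : R -> R, H t0 = 0 /\ forall t, t0 <= t -> is_derive t 1 H (h t).
Proof.
move=> ch.
(* Integration starts at t0 - 1 so that t0 is an interior point and the derivative there is
   two-sided; the value at t0 is subtracted at the end. *)
pose F := fun x : R => (\int[lebesgue_measure]_(t in `[(t0 - 1), x]) h t)%R.
have dF t : t0 <= t -> is_derive t 1 F (h t).
  move=> tt.
  have [||||dF F'] := @continuous_FTC1_closed R h (t0 - 1) t (t + 1).
  - by rewrite ltrDl.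
  - apply: continuous_compact_integrable; first exact: segment_compact.
    exact: continuous_subspaceT.
  - by rewrite ltrBlDr (le_lt_trans tt)// ltrDl.
  - exact: ch.
  - by apply: DeriveDef; [exact: dF|rewrite -derive1E; exact: F'].
exists (fun t => F t - F t0); split=> [|t tt]; first by rewrite subrr.
have -> : h t = h t - 0 by rewrite subr0.
by apply: is_deriveB; exact: dF.
Qed.

(** The bound expR x >= 1 + x already gives the explicit time |K| / (a e). *)
Lemma exp_tail (a K e : R) : 0 < a -> 0 < e ->
  exists T, 0 <= T /\ forall t, T <= t -> expR (- a * t) * K <= e.
Proof.
move=> a0 e0; exists (`|K| / (a * e)); split=> [|t].
  by rewrite divr_ge0// ltW// mulr_gt0.
rewrite ler_pdivrMr ?mulr_gt0// => Ht.
rewrite mulNr expRN mulrC ler_pdivrMr ?expR_gt0//.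
have := expR_ge1Dx (a * t); rewrite -(ler_pM2l e0).
by have := ler_norm K; move: Ht e0; lra.
Qed.

End HalfLine.

(** * Global solutions of Lipschitz systems *)

Section Picard.
Context {R : realType}.

(** With g n = 2 C / 2^n, which satisfies g n = 2 g (n + 1), the intervals of centre x n and radius
    g n are nested; the supremum of their left ends lies in all of them. *)
Lemma geometric_limit (x : nat -> R) (C : R) :
  (forall n, `|x n.+1 - x n| <= C / 2 ^+ n) ->
  exists l, forall n, `|x n - l| <= 2 * C / 2 ^+ n.
Proof.
move=> H.
pose g n := 2 * C / 2 ^+ n.
have gS n : g n.+1 = C / 2 ^+ n.
  by rewrite /g exprS invfM mulrA -[2 * C * _]mulrA (mulrC C) mulrA divff ?mul1r.
have g2 n : g n = 2 * g n.+1 by rewrite gS /g mulrA.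
have up m n : x n - g n <= x (n + m)%N - g (n + m)%N.
  elim: m n => [|m IH] n; first by rewrite addn0.
  rewrite addnS -addSn; apply: le_trans (IH n.+1).
  by have := H n; rewrite -gS ler_norml (g2 n) => /andP[]; lra.
have dn m n : x (n + m)%N + g (n + m)%N <= x n + g n.
  elim: m n => [|m IH] n; first by rewrite addn0.
  rewrite addnS -addSn; apply: le_trans (IH n.+1) _.
  by have := H n; rewrite -gS ler_norml (g2 n) => /andP[]; lra.
have g0 n : 0 <= g n by rewrite g2 mulr_ge0// gS (le_trans _ (H n)).
have ab m n : x n - g n <= x m + g m.
  apply: (le_trans (up m n)); apply: le_trans (dn n m); rewrite addnC.
  by rewrite lerD2l (le_trans _ (g0 _))// oppr_le0.
pose S := range (fun n => x n - g n).
have ubS m : ubound S (x m + g m) by move=> _ [n _ <-]; exact: ab.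
exists (sup S) => n; rewrite -/(g n) ler_norml.
have : sup S <= x n + g n by apply: ge_sup => //; exists (x 0%N - g 0%N); exists 0%N.
have : x n - g n <= sup S by apply: ub_le_sup; [exists (x n + g n)|exists n].
by move=> ? ?; apply/andP; split; lra.
Qed.

Lemma continuous_clamp (t0 : R) : continuous (fun t : R => Num.max t t0).
Proof. by move=> t; apply: continuous_max; [exact: cvg_id|exact: cvg_cst]. Qed.

Lemma half_small (C e : R) : 0 < e -> exists n, C / 2 ^+ n <= e.
Proof.
move=> e0; have [n Hn] : exists n : nat, C / e <= n%:R.
  by exists (Num.truncn (C / e)).+1; rewrite ltW// truncnS_gt.
exists n; rewrite ler_pdivrMr ?exprn_gt0// mulrC -ler_pdivrMr//.
by apply: le_trans Hn _; rewrite -natrX ler_nat ltnW// ltn_expl.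
Qed.

(** The derivative of E = k exp(la (s - t0)) dominates |g|, so E - G and E + G are both
    nondecreasing; the term E t0 = k >= 0 is then dropped. *)
Lemma exp_growth (G g : R -> R) (t0 t k la : R) : t0 <= t -> 0 <= k ->
  (forall s, t0 <= s <= t -> is_derive s 1 G (g s)) ->
  (forall s, t0 <= s <= t -> `|g s| <= k * (la * expR (la * (s - t0)))) ->
  `|G t - G t0| <= k * expR (la * (t - t0)).
Proof.
move=> tt k0 dG gle.
pose E s := k * expR (la * (s - t0)).
pose E' s := k * (la * expR (la * (s - t0))).
have E0 : E t0 = k by rewrite /E subrr mulr0 expR0 mulr1.
have dE (s : R) : is_derive s 1 E (E' s) by exact: derZ (der_expl la t0 s).
have gE s : t0 <= s <= t -> - E' s <= g s <= E' s.
  by move=> /gle; rewrite ler_norml.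
have up : E t0 - G t0 <= E t - G t.
  have d (s : R) : t0 <= s <= t -> is_derive s 1 (fun s => E s - G s) (E' s - g s).
    by move=> st; exact: derB (dE _) (dG _ st).
  have p s : t0 <= s <= t -> 0 <= E' s - g s.
    by move=> /gE/andP[_]; rewrite subr_ge0.
  exact: (der_nondecreasing tt d p).
have dn : E t0 + G t0 <= E t + G t.
  have d (s : R) : t0 <= s <= t -> is_derive s 1 (fun s => E s + G s) (E' s + g s).
    by move=> st; exact: derD (dE _) (dG _ st).
  have p s : t0 <= s <= t -> 0 <= E' s + g s.
    by move=> /gE/andP[+ _]; rewrite -subr_ge0 opprK addrC.
  exact: (der_nondecreasing tt d p).
by rewrite -/(E t) ler_norml; apply/andP; split; lra.
Qed.

Variables (I : finType) (t0 L M : R) (F : R -> (I -> R) -> I -> R) (u0 : I -> R).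
Hypotheses (L0 : 0 <= L) (M0 : 0 <= M).
Hypothesis FL : forall t u v i, t0 <= t ->
  `|F t u i - F t v i| <= L * \sum_j `|u j - v j|.
Hypothesis Fcont : forall u : I -> R -> R, (forall j, continuous (u j)) ->
  forall i, continuous (fun t => F t (u ^~ t) i).
Hypothesis FM : forall t i, t0 <= t -> `|F t u0 i| <= M * expR (t - t0).

(** In the norm weighted by exp(-la (t - t0)) the Picard map halves distances on the whole half-line
    at once, so no continuation of local solutions is required. *)
Lemma global_picard : exists u : I -> R -> R,
  (forall i, u i t0 = u0 i) /\
  forall t, t0 <= t -> forall i, is_derive t 1 (u i) (F t (u ^~ t) i).
Proof.
pose cont (c : I -> R -> R) := forall j, continuous (c j).
(* [S] is the Picard map, made total by the dummy value 0 on curves that are not continuous. *)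
have /choice[S HS] : forall c : I -> R -> R, exists s : I -> R -> R, cont c ->
    (forall i, s i t0 = u0 i) /\
    forall t, t0 <= t -> forall i, is_derive t 1 (s i) (F t (c ^~ t) i).
  move=> c.
  have [cc|ncc] := pselect (cont c); last by exists (fun _ _ => 0).
  have /choice[H HH] : forall i, exists H : R -> R, H t0 = 0 /\
      forall t, t0 <= t -> is_derive t 1 H (F t (c ^~ t) i).
    by move=> i; apply: primitive; exact: Fcont.
  exists (fun i t => u0 i + H i t) => _; split=> [i|t tt i].
    by rewrite (HH i).1 addr0.
  have := derD (derC (u0 i) t) ((HH i).2 t tt).
  by rewrite add0r.
(* [S c] is controlled only from t0 on. Freezing it before t0 makes it continuous everywhere, so the
   map can be iterated. *)
pose stop (c : I -> R -> R) i t := c i (Num.max t t0).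
have stopE c i t : t0 <= t -> stop c i t = c i t by move=> tt; rewrite /stop max_l.
have cont_stop (c : I -> R -> R) :
    (forall i t, t0 <= t -> {for t, continuous (c i)}) -> cont (stop c).
  move=> cc i t; apply: (@continuous_comp _ _ _ (fun t => Num.max t t0) (c i)).
    exact: continuous_clamp.
  by apply: cc; rewrite le_max lexx orbT.
have contS c : cont c -> cont (stop (S c)).
  move=> /HS[_ dS]; apply: cont_stop => i t tt; exact: der_cont (dS _ tt i).
pose n := #|I|%:R : R.
(* The part 2 L n yields the contraction factor 1/2; the summand 1 makes la >= 1, so that the weight
   dominates the growth allowed by [FM]. *)
pose la := 2 * L * n + 1.
have n0 : 0 <= n by rewrite ler0n.
have la1 : 1 <= la by rewrite lerDr !mulr_ge0.
pose ex t := expR (la * (t - t0)).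
have ex0 t : 0 <= ex t by exact: expR_ge0.
have contr c c' k : cont c -> cont c' -> 0 <= k ->
    (forall i t, t0 <= t -> `|c i t - c' i t| <= k * ex t) ->
    forall i t, t0 <= t -> `|S c i t - S c' i t| <= k / 2 * ex t.
  move=> cc cc' k0 H i t tt; have [S0 dS] := HS _ cc; have [S0' dS'] := HS _ cc'.
  have -> : S c i t - S c' i t = S c i t - S c' i t - (S c i t0 - S c' i t0).
    by rewrite S0 S0' subrr subr0.
  apply: (@exp_growth (fun t => S c i t - S c' i t)
    (fun t => F t (c ^~ t) i - F t (c' ^~ t) i)) => //; first by rewrite divr_ge0.
    by move=> s /andP[st _]; apply: derB; [exact: dS|exact: dS'].
  move=> s /andP[st _]; apply: (le_trans (FL _ _ _ st)).
  apply: (@le_trans _ _ (L * \sum_(j : I) k * ex s)).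
    by rewrite ler_wpM2l// ler_sum// => j _; exact: H.
  rewrite sumr_const -[_ *+ #|_|]mulr_natl -/n -/(ex s) /la.
  have : 0 <= k * ex s by rewrite mulr_ge0.
  by lra.
pose c m := iter m (fun c => stop (S c)) (fun i _ => u0 i).
have cc m : cont (c m).
  by elim: m => [|m IH]; [move=> i t; exact: cvg_cst|exact: contS].
have cdiff m i t : t0 <= t -> `|c m.+1 i t - c m i t| <= M * ex t / 2 ^+ m.
  elim: m i t => [|m IH] i t tt.
    rewrite expr0 divr1 /= stopE//; have [S0 dS] := HS _ (cc 0%N).
    rewrite -(S0 i).
    apply: exp_growth => //; first by move=> s /andP[st _]; exact: dS.
    move=> s /andP[st _]; apply: (le_trans (FM _ st)); rewrite ler_wpM2l//.
    have s0 : 0 <= s - t0 by rewrite subr_ge0.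
    apply: (@le_trans _ _ (expR (la * (s - t0)))).
      by rewrite ler_expR ler_peMl.
    by rewrite ler_peMl// expR_ge0.
  rewrite [X in `|X - _|]stopE// [X in `|_ - X|]stopE//.
  rewrite mulrAC; rewrite exprSr invfM mulrA.
  apply: (contr (c m.+1) (c m) _ (cc _) (cc _)) => //.
    by rewrite divr_ge0// exprn_ge0.
  by move=> j s st; rewrite mulrAC; exact: IH.
have [u Hu] : exists u : I -> R -> R, forall i t, t0 <= t ->
    forall m, `|c m i t - u i t| <= 2 * (M * ex t) / 2 ^+ m.
  have /choice[u Hu] : forall it : I * R, exists l : R, t0 <= it.2 ->
      forall m, `|c m it.1 it.2 - l| <= 2 * (M * ex it.2) / 2 ^+ m.
    move=> [i t] /=; have [tt|tt] := boolP (t0 <= t); last by exists 0.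
    by have [l Hl] := geometric_limit (fun m => cdiff m i t tt); exists l.
  by exists (fun i t => u (i, t)) => i t; exact: (Hu (i, t)).
have cu : cont (stop u).
  move=> i t; apply/cvgrPdist_le => e e0.
  (* On the unit neighbourhood of t the weight is bounded, so the iterates converge uniformly there
     and their limit is continuous by the usual argument with e / 3. *)
  pose K := 2 * (M * expR (la * (`|t - t0| + 1))).
  have [m Hm] := half_small K (divr_gt0 e0 (ltr0n R 3)).
  have clo s : `|t - s| < 1 -> `|c m i (Num.max s t0) - stop u i s| <= e / 3.
    move=> ts; have st : t0 <= Num.max s t0 by rewrite le_max lexx orbT.
    apply: le_trans (Hu i _ st m) _; apply: le_trans Hm.
    rewrite ler_wpM2r ?invr_ge0 ?exprn_ge0// /K ler_wpM2l// ler_wpM2l//.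
    rewrite ler_expR ler_wpM2l ?(le_trans _ la1)//.
    have := ler_norm (t - t0); have := normr_ge0 (t - t0).
    by move: ts; rewrite ltr_norml maxEle; case: ifP => _ /andP[]; lra.
  have /(_ t)/cvgrPdist_le/(_ _ (divr_gt0 e0 (ltr0n R 3))) :
      continuous (stop (c m) i) by apply: cont_stop => j s _; exact: cc.
  move=> near1; near=> s.
  have := clo t; have := clo s.
  rewrite subrr normr0 => /(_ _)H1 /(_ ltr01).
  have {}H1 : `|c m i (Num.max s t0) - stop u i s| <= e / 3.
    by apply: H1; near: s; exact: cvgr_dist_lt.
  have H2 : `|stop (c m) i t - stop (c m) i s| <= e / 3 by near: s.
  move: H1 H2; rewrite /stop !ler_norml => /andP[? ?] /andP[? ?] /andP[? ?].
  by apply/andP; split; lra.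
have [S0 dS] := HS _ cu.
(* Both sides are within O(2^-m) of the iterate of index m + 1: the left by contraction, the right
   by the choice of u. *)
have Su i t : t0 <= t -> S (stop u) i t = u i t.
  move=> tt; apply/eqP; rewrite -subr_eq0 -normr_le0; apply/ler_addgt0Pr => e e0.
  have [m Hm] := half_small (2 * (M * ex t)) e0.
  rewrite add0r; apply: le_trans Hm.
  have H1 := Hu i t tt m.+1.
  have := @contr (stop u) (c m) (2 * M / 2 ^+ m) cu (cc m).
  rewrite divr_ge0 ?exprn_ge0 ?mulr_ge0// => /(_ isT) H2.
  have {}H2 : `|S (stop u) i t - S (c m) i t| <= 2 * M / 2 ^+ m / 2 * ex t.
    apply: H2 => // j s st; rewrite stopE// distrC.
    by apply: le_trans (Hu j s st m) _; rewrite mulrA mulrAC.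
  move: H1; rewrite [X in `|X - _|]stopE// => H1.
  have -> : S (stop u) i t - u i t =
      (S (stop u) i t - S (c m) i t) + (S (c m) i t - u i t).
    by rewrite addrA subrK.
  apply: (le_trans (ler_normD _ _)); apply: (le_trans (lerD H2 H1)).
  rewrite exprS invfM le_eqVlt; apply/orP; left; apply/eqP.
  by field; rewrite expf_neq0.
exists (S (stop u)); split=> [//|t tt i].
have := dS t tt i; have -> // : stop u ^~ t = S (stop u) ^~ t.
by apply/funext => j; rewrite Su// stopE.
Unshelve. all: by end_near.
Qed.

End Picard.

(** * Regularity of the costs *)

Section Calculus.
Context {R : realType} {n : nat}.
Implicit Types (g : 'rV[R]_n -> R) (x y v : 'rV[R]_n).

Definition box (rho : R) x := forall j, `|x 0 j| <= rho.

Definition clamp (rho : R) x : 'rV[R]_n :=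
  \row_j Num.max (- rho) (Num.min rho (x 0 j)).

Lemma clamp_box (rho : R) x : 0 <= rho -> box rho (clamp rho x).
Proof.
move=> r0 j; rewrite mxE ler_norml le_max lexx /= ge_max ge_min lexx /= andbT.
by rewrite -subr_ge0 opprK addr_ge0.
Qed.

Lemma clamp_id (rho : R) x : box rho x -> clamp rho x = x.
Proof.
move=> bx; apply/rowP => j; rewrite mxE; have := bx j; rewrite ler_norml.
by case/andP=> lo hi; rewrite min_r// max_r.
Qed.

Lemma clamp_lip (rho : R) x y j :
  `|clamp rho x 0 j - clamp rho y 0 j| <= `|x 0 j - y 0 j|.
Proof.
rewrite !mxE; move: (x 0 j) (y 0 j) => a b.
have dist (u w : R) : u - w <= `|u - w| /\ w - u <= `|u - w|.
  by rewrite ler_norm distrC ler_norm.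
have max_lip (c u w : R) : `|Num.max c u - Num.max c w| <= `|u - w|.
  have [? ?] := dist u w; rewrite ler_norml; apply/andP.
  by case: (leP c u); case: (leP c w) => ? ?; split; lra.
have min_lip (c u w : R) : `|Num.min c u - Num.min c w| <= `|u - w|.
  have [? ?] := dist u w; rewrite ler_norml; apply/andP.
  by case: (leP c u); case: (leP c w) => ? ?; split; lra.
exact: le_trans (max_lip _ _ _) (min_lip _ _ _).
Qed.

Lemma derive_line g x v (s : R) : differentiable g (x + s *: v) ->
  is_derive s 1 (fun r => g (x + r *: v)) ('D_v g (x + s *: v)).
Proof.
move=> dg.
have E : (fun h : R => h^-1 *: (((fun r => g (x + r *: v)) \o shift s) (h *: 1)
                              - g (x + s *: v)))
       = (fun h => h^-1 *: ((g \o shift (x + s *: v)) (h *: v) - g (x + s *: v))).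
  apply/funext => h /=.
  have -> : h *: (1 : R) = h by rewrite /GRing.scale /= mulr1.
  by rewrite scalerDl addrCA.
apply: DeriveDef; first by rewrite /derivable E; exact: diff_derivable.
by rewrite /derive E.
Qed.

Lemma derive_partial g x v : differentiable g x ->
  'D_v g x = \sum_j v 0 j * partial j g x.
Proof.
move=> dg; rewrite deriveE// [X in 'd g x X]row_sum_delta linear_sum.
by apply: eq_bigr => j _; rewrite linearZ /= /partial deriveE.
Qed.

Lemma bounded_box g (rho : R) : continuous g ->
  exists B, 0 <= B /\ forall x, box rho x -> `|g x| <= B.
Proof.
move=> cg; pose K := [set x : 'rV[R]_n | forall j, [set` `[- rho, rho]] (x ord0 j)].
have cK : compact K by apply: (@rV_compact _ _ (fun=> [set` `[- rho, rho]])) => j; exact: segment_compact.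
have := continuous_compact (continuous_subspaceT cg) cK.
move=> /compact_bounded[M [_ HM]].
exists (Num.max 0 (M + 1)); split=> [|x bx]; first by rewrite le_max lexx.
apply: le_trans (HM (M + 1) _ _ _) _; first by rewrite ltrDl.
  by exists x => // j; rewrite /= in_itv /= -ler_norml.
by rewrite le_max lexx orbT.
Qed.

(** Mean value theorem along the segment from y to x, which stays in the convex box, where the
    continuous partial derivatives are bounded by compactness. *)
Lemma lipschitz_box g (rho : R) : C1 g -> exists L, 0 <= L /\
  forall x y, box rho x -> box rho y ->
    `|g x - g y| <= L * \sum_j `|x 0 j - y 0 j|.
Proof.
move=> [dg cg].
have /choice[B HB] := fun j => bounded_box rho (cg j).
exists (\sum_j B j); split; first by apply: sumr_ge0 => j _; exact: (HB j).1.
move=> x y bx by_; pose v := x - y.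
have [||s s01] := @MVT_segment R (fun r => g (y + r *: v))
  (fun r => 'D_v g (y + r *: v)) 0 1 ler01.
- by move=> s _; exact: derive_line.
- apply: continuous_subspaceT => s; apply: der_cont.
  exact: derive_line.
have -> : y + 1 *: v = x by rewrite scale1r addrC subrK.
rewrite scale0r addr0 subr0 mulr1 => ->.
rewrite derive_partial// (le_trans (ler_norm_sum _ _ _))// mulr_sumr.
apply: ler_sum => j _; rewrite normrM /v !mxE mulrC ler_wpM2r//.
apply: (@le_trans _ _ (B j)).
  apply: (HB j).2 => k; move: s01; rewrite in_itv /= => /andP[s0 s1].
  have := bx k; have := by_ k; rewrite !ler_norml !mxE => /andP[? ?] /andP[? ?].
  by apply/andP; split; nra.
rewrite (bigD1 j)//= lerDl; apply: sumr_ge0 => k _; exact: (HB k).1.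
Qed.

End Calculus.

(** A unilateral deviation moves along the i-th axis through xs, so [f i] has a minimum at xs on
    that line and Fermat's rule applies. *)
Lemma nash_stationary (R : realType) (N : nat) (f : 'I_N -> 'rV[R]_N -> R)
    (xs : 'rV[R]_N) i : (forall x, differentiable (f i) x) ->
  nash_equilibrium f xs -> partial i (f i) xs = 0.
Proof.
move=> df nash; pose v : 'rV[R]_N := delta_mx 0 i.
pose phi s := f i (xs + s *: v).
have dphi (s : R) : is_derive s 1 phi ('D_v (f i) (xs + s *: v)).
  exact: derive_line.
have d0 : is_derive (0 : R) 1 phi 0.
  apply: (@derive1_at_min _ phi (-1) 1) => [|t _| |t _].
  - by rewrite -subr_ge0 opprK addr_ge0.
  - exact: der_derivable (dphi t).
  - by rewrite in_itv /= ltrN10 ltr01.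
  rewrite /phi scale0r addr0.
  have -> : xs + t *: v = deviate xs i (xs 0 i + t) by
    apply/rowP => j; rewrite !mxE eqxx /=; case: eqVneq => [->|_];
    rewrite ?mulr1 ?mulr0 ?addr0.
  exact: nash.
have := dphi 0; rewrite scale0r addr0 => d1.
by have := @derive_val _ _ _ _ _ _ _ d0; rewrite (@derive_val _ _ _ _ _ _ _ d1).
Qed.

(** * Dissipation inequalities *)

Section Finite.
Context {R : realType}.

(** The summand 1 keeps the bound positive even for an empty index type. Constants found per player
    or per pair are made uniform this way. *)
Lemma finite_ub (I : finType) (a : I -> R) :
  exists2 b, 0 < b & forall i, a i <= b.
Proof.
exists (1 + \sum_i `|a i|) => [|i].
  by rewrite ltr_pwDl// sumr_ge0.
rewrite (le_trans (ler_norm _))// (bigD1 i)//= addrCA lerDl.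
by rewrite addr_ge0// sumr_ge0.
Qed.

Lemma finite_lb (I : finType) (a : I -> R) : (forall i, 0 < a i) ->
  exists2 b, 0 < b & forall i, b <= a i.
Proof.
move=> a0; have [b b0 ab] := finite_ub (fun i => (a i)^-1).
exists b^-1 => [|i]; first by rewrite invr_gt0.
by rewrite -[a i]invrK lef_pV2 ?posrE ?invr_gt0.
Qed.

Lemma le_sum_term (I : finType) (a : I -> R) i :
  (forall j, 0 <= a j) -> a i <= \sum_j a j.
Proof. by move=> a0; rewrite (bigD1 i)//= lerDl sumr_ge0. Qed.

Lemma young (h x y : R) : 0 < h -> 2 * (x * y) <= h * x ^+ 2 + y ^+ 2 / h.
Proof.
move=> h0; rewrite -subr_ge0.
have -> : h * x ^+ 2 + y ^+ 2 / h - 2 * (x * y) = (h * x - y) ^+ 2 / h.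
  by field; rewrite gt_eqF.
by rewrite divr_ge0 ?sqr_ge0 // ltW.
Qed.

End Finite.

(** * Coercivity of the pinned graph Laplacian *)

Section Graph.
Context {R : realType} {N : nat}.
Variable A : 'M[R]_N.
Hypotheses (hN : (2 <= N)%N) (hA : is_adjacency A) (hundirected : undirected A).
Hypothesis hconnected : connected_graph A.

(** Quadratic form of the graph Laplacian plus the diagonal matrix of the weights [A i j]. The N
    estimates of x_j interact only with one another, so the consensus form splits into one such form
    for each j. *)
Let pinned (j : 'I_N) (v : 'I_N -> R) :=
  \sum_i v i * (\sum_k A i k * (v i - v k) + A i j * v i).

(** Symmetrization: exchanging i and k in the double sum and adding the two copies turns v_i (v_i -
    v_k) into a squared difference, since the weights are symmetric. *)
Lemma pinned_dirichlet j v : 2 * pinned j v =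
  \sum_i \sum_k A i k * (v i - v k) ^+ 2 + 2 * \sum_i A i j * v i ^+ 2.
Proof.
pose S := \sum_i \sum_k A i k * (v i * (v i - v k)).
have S' : S = \sum_i \sum_k A i k * (v k * (v k - v i)).
  rewrite /S exchange_big; apply: eq_bigr => i _; apply: eq_bigr => k _.
  by rewrite hundirected.
have -> : pinned j v = S + \sum_i A i j * v i ^+ 2.
  rewrite /S -big_split; apply: eq_bigr => i _ /=.
  rewrite mulrDr mulr_sumr; congr (_ + _); last by ring.
  by apply: eq_bigr => k _; ring.
rewrite mulrDr; congr (_ + _).
rewrite mulrDl mul1r {2}S' /S -big_split; apply: eq_bigr => i _ /=.
by rewrite -big_split; apply: eq_bigr => k _ /=; ring.
Qed.

Lemma pinned_edge j v i k : A i k * (v i - v k) ^+ 2 <= 2 * pinned j v.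
Proof.
rewrite pinned_dirichlet (bigD1 i)//= (bigD1 k)//= -!addrA lerDl.
have [A0 _] := hA.
rewrite !addr_ge0 ?mulr_ge0 ?sumr_ge0// => *; rewrite ?sumr_ge0//.
- by move=> *; rewrite mulr_ge0// sqr_ge0.
- by move=> *; rewrite mulr_ge0// sqr_ge0.
- by rewrite mulr_ge0// sqr_ge0.
Qed.

Lemma pinned_self j v i : A i j * v i ^+ 2 <= pinned j v.
Proof.
have [A0 _] := hA.
have := @le_sum_term R _ (fun k => A k j * v k ^+ 2) i.
move=> /(_ (fun k => mulr_ge0 (A0 k j) (sqr_ge0 _))) H.
have : 0 <= \sum_i \sum_k A i k * (v i - v k) ^+ 2.
  by do 2![apply: sumr_ge0 => ? _]; rewrite mulr_ge0// sqr_ge0.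
by have := pinned_dirichlet j v; lra.
Qed.

Lemma pinned_ge0 j v : 0 <= pinned j v.
Proof.
have [A0 _] := hA.
by apply: le_trans (pinned_self j v j); rewrite mulr_ge0// sqr_ge0.
Qed.

(* Some node is pinned directly to j, and control propagates along edges. *)
Lemma pinned_controls j i : exists2 C, 0 < C &
  forall v, v i ^+ 2 <= C * pinned j v.
Proof.
have [A0 Ad] := hA.
have [l Alj] : exists l, 0 < A l j.
  (* N >= 2 provides a second node; the first edge of a path from j to it ends at a node l with
     [A l j] positive. *)
  have [k kj] : exists k : 'I_N, k != j.
    have [/eqP j0|j0] := boolP (val j == 0%N).
      by exists (Ordinal hN); rewrite -val_eqE /= j0.
    by exists (Ordinal (ltnW hN)); rewrite -val_eqE /= eq_sym.
  rewrite eq_sym in kj; have /connectP[[|l p] /=] := hconnected kj.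
    by move=> _ E; rewrite E eqxx in kj.
  by move=> /andP[jl _] _; exists l.
have base : exists2 C, 0 < C & forall v, v l ^+ 2 <= C * pinned j v.
  exists (A l j)^-1 => [|v]; first by rewrite invr_gt0.
  by rewrite -ler_pdivrMl ?invr_gt0// invrK pinned_self.
have [<-//|li] := eqVneq l i.
have /connectP[p pp ->] := hconnected li.
elim: p l base pp {Alj li} => [|k p IH] l base //= /andP[lk pp].
apply: IH pp; have [C C0 HC] := base; have Akl : 0 < A k l by exact: lk.
(* From v_k^2 <= 2 v_l^2 + 2 (v_k - v_l)^2, where the last square is at most 2 / [A k l] times the
   form by [pinned_edge]. *)
exists (2 * C + 4 / A k l) => [|v]; first by rewrite addr_gt0 ?mulr_gt0 ?invr_gt0.
have := pinned_edge j v k l; rewrite -ler_pdivlMl// => H1.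
have := HC v => H2.
rewrite mulrDl -!mulrA.
have : v k ^+ 2 <= 2 * v l ^+ 2 + 2 * (v k - v l) ^+ 2.
  rewrite -subr_ge0.
  have -> : 2 * v l ^+ 2 + 2 * (v k - v l) ^+ 2 - v k ^+ 2 =
    (2 * v l - v k) ^+ 2 by ring.
  exact: sqr_ge0.
by move: H1 H2; lra.
Qed.

(** For each j every one of the N nodes is controlled with a common constant K; adding the N bounds
    costs the factor N in mu. *)
Lemma pinned_coercive : exists2 mu, 0 < mu & forall e : 'I_N -> 'I_N -> R,
  mu * (\sum_i \sum_j e i j ^+ 2) <= \sum_i \sum_j
    e i j * (\sum_k A i k * (e i j - e k j) + A i j * e i j).
Proof.
have /choice[C HC] : forall ij : 'I_N * 'I_N, exists C, 0 < C /\
    forall v, v ij.1 ^+ 2 <= C * pinned ij.2 v.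
  by move=> [i j] /=; have [C ? ?] := pinned_controls j i; exists C.
have [K K0 HK] := finite_ub C.
have N0 : 0 < N%:R :> R by rewrite ltr0n (leq_trans _ hN).
exists (K * N%:R)^-1 => [|e]; first by rewrite invr_gt0 mulr_gt0.
rewrite -ler_pdivlMl ?invr_gt0 ?mulr_gt0// invrK.
rewrite exchange_big [in leRHS]exchange_big mulr_sumr; apply: ler_sum => j _.
apply: (@le_trans _ _ (\sum_(i < N) K * pinned j (e ^~ j))); last first.
  by rewrite sumr_const card_ord -[leLHS]mulr_natr mulrAC.
apply: ler_sum => i _; apply: le_trans ((HC (i, j)).2 (e ^~ j)) _.
by rewrite ler_wpM2r ?pinned_ge0// HK.
Qed.

End Graph.

(** * Decay rates of the three Lyapunov functions *)

Section LyapunovRates.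
Context {R : realType} {N : nat}.

(* With w = e1 - (k1 / k2) e2, along e1' = sigma (e2 - k1 e1) and
   e2' = - sigma k2 e1 the form k2 w^2 + e2^2 dissipates e2^2 and the form
   k2 e1^2 + e2^2 dissipates e1^2. *)
Definition Vobs (k1 k2 e1 e2 : 'I_N -> R) : R :=
  \sum_i (k2 i * (e1 i - k1 i / k2 i * e2 i) ^+ 2 + k2 i * e1 i ^+ 2 + 2 * e2 i ^+ 2).

(** The weights cancel the gains [thetabar i j] in the derivative, which leaves -theta times the
    pinned forms. *)
Definition Vest (thetabar : 'M[R]_N) (e : 'I_N -> 'I_N -> R) : R :=
  \sum_i \sum_j e i j ^+ 2 / (2 * thetabar i j).

Definition Vact (p : 'I_N -> R) : R := \sum_i p i ^+ 2 / 2.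

Variables (k1 k2 : 'I_N -> R) (M : R).
Hypotheses (hk1 : forall i, 0 < k1 i) (hk2 : forall i, 0 < k2 i).

(** With the weights h, h, 2 the products e1 e2 cancel and exactly -2 k sigma (e2^2 + h e1^2)
    remains. Half of this dissipation absorbs the disturbance d / sigma, whose square divided by the
    rate sigma leaves 1 / sigma^3. *)
Lemma observer_rate1 (k h : R) : 0 < k -> 0 < h -> exists2 a, 0 < a &
  exists2 b, 0 <= b & forall sigma e1 e2 w d,
    0 < sigma -> `|d| <= M -> w = e1 - k / h * e2 ->
    2 * h * w * (sigma * e2 - k / h * (d / sigma)) +
    2 * h * e1 * (sigma * (e2 - k * e1)) + 4 * e2 * (d / sigma - sigma * h * e1)
    <= - (a * sigma) * (h * w ^+ 2 + h * e1 ^+ 2 + 2 * e2 ^+ 2) + b / sigma ^+ 3.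
Proof.
move=> k0 h0; pose r := k / h.
have kE : k = r * h by rewrite /r divfK// gt_eqF.
have r0 : 0 < r by rewrite divr_gt0.
(* Since h r = k, h w^2 <= 2 h e1^2 + 2 k r e2^2, so the Lyapunov form is at most 3 + 2 k r times
   e2^2 + h e1^2. *)
pose a := k / (3 + 2 * k * r).
have den0 : 0 < 3 + 2 * k * r by rewrite addr_gt0// mulr_gt0// mulr_gt0.
have a0 : 0 < a by rewrite divr_gt0.
exists a => //; exists (M ^+ 2 * (k ^+ 2 / h + 2) / a).
  by rewrite divr_ge0 ?(ltW a0)// mulr_ge0 ?sqr_ge0// addr_ge0// divr_ge0 ?sqr_ge0 ?ltW.
move=> sigma e1 e2 w d s0 dM; rewrite -/r => wE; pose dl := d / sigma.
rewrite -/dl.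
have aE : k = a * (3 + 2 * k * r) by rewrite /a divfK// gt_eqF.
have -> : 2 * h * w * (sigma * e2 - r * dl) +
    2 * h * e1 * (sigma * (e2 - k * e1)) + 4 * e2 * (dl - sigma * h * e1) =
    - (2 * k * sigma) * (e2 ^+ 2 + h * e1 ^+ 2) +
    (2 * (w * (- k * dl)) + 2 * (e2 * (2 * dl))).
  by rewrite wE kE; ring.
have as0 : 0 < a * sigma by rewrite mulr_gt0.
have Y1 := young w (- k * dl) (mulr_gt0 as0 h0).
have Y2 := young e2 (2 * dl) (mulr_gt0 (ltr0n R 2) as0).
have dl2 : dl ^+ 2 <= M ^+ 2 / sigma ^+ 2.
  rewrite /dl expr_div_n ler_wpM2r ?invr_ge0 ?sqr_ge0//.
  by rewrite -real_normK ?num_real// ler_sqr ?nnegrE// (le_trans _ dM).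
have Yd : (- k * dl) ^+ 2 / (a * sigma * h) + (2 * dl) ^+ 2 / (2 * (a * sigma)) <=
    M ^+ 2 * (k ^+ 2 / h + 2) / a / sigma ^+ 3.
  have -> : (- k * dl) ^+ 2 / (a * sigma * h) + (2 * dl) ^+ 2 / (2 * (a * sigma))
    = dl ^+ 2 * ((k ^+ 2 / h + 2) / (a * sigma)).
    by field; rewrite !gt_eqF.
  have -> : M ^+ 2 * (k ^+ 2 / h + 2) / a / sigma ^+ 3 =
    M ^+ 2 / sigma ^+ 2 * ((k ^+ 2 / h + 2) / (a * sigma)).
    by field; rewrite !gt_eqF.
  rewrite ler_wpM2r// divr_ge0 ?(ltW as0)// addr_ge0// divr_ge0 ?sqr_ge0 ?ltW//.
have W : h * w ^+ 2 + h * e1 ^+ 2 + 2 * e2 ^+ 2 <=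
    (3 + 2 * k * r) * (e2 ^+ 2 + h * e1 ^+ 2).
  rewrite -subr_ge0.
  have -> : (3 + 2 * k * r) * (e2 ^+ 2 + h * e1 ^+ 2) -
      (h * w ^+ 2 + h * e1 ^+ 2 + 2 * e2 ^+ 2) =
    e2 ^+ 2 + 2 * k * r * (h * e1 ^+ 2) + h * (e1 + r * e2) ^+ 2.
    by rewrite wE kE; ring.
  have := mulr_ge0 (mulr_ge0 (ltW k0) (ltW r0)) (mulr_ge0 (ltW h0) (sqr_ge0 e1)).
  by have := mulr_ge0 (ltW h0) (sqr_ge0 (e1 + r * e2)); have := sqr_ge0 e2; lra.
have : 2 * (a * sigma) * (h * w ^+ 2 + h * e1 ^+ 2 + 2 * e2 ^+ 2) <=
    2 * k * sigma * (e2 ^+ 2 + h * e1 ^+ 2).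
  have -> : 2 * k * sigma * (e2 ^+ 2 + h * e1 ^+ 2) =
     2 * (a * sigma) * ((3 + 2 * k * r) * (e2 ^+ 2 + h * e1 ^+ 2)).
    by rewrite {1}aE; ring.
  by rewrite ler_wpM2l// mulr_ge0// ltW.
have := mulr_ge0 (ltW as0) (mulr_ge0 (ltW h0) (sqr_ge0 e1)).
by move: Y1 Y2 Yd; lra.
Qed.


Lemma observer_rate : exists2 a, 0 < a &
  exists2 b, 0 <= b & forall sigma e1 e2 d, 0 < sigma ->
    (forall i, `|d i| <= M) ->
    \sum_i (2 * k2 i * (e1 i - k1 i / k2 i * e2 i) *
        (sigma * e2 i - k1 i / k2 i * (d i / sigma)) +
      2 * k2 i * e1 i * (sigma * (e2 i - k1 i * e1 i)) +
      4 * e2 i * (d i / sigma - sigma * k2 i * e1 i))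
    <= - (a * sigma) * Vobs k1 k2 e1 e2 + b / sigma ^+ 3.
Proof.
have /choice[ab Hab] : forall i, exists ab : R * R, 0 < ab.1 /\ 0 <= ab.2 /\
    forall sigma e1 e2 w d, 0 < sigma -> `|d| <= M -> w = e1 - k1 i / k2 i * e2 ->
    2 * k2 i * w * (sigma * e2 - k1 i / k2 i * (d / sigma)) +
    2 * k2 i * e1 * (sigma * (e2 - k1 i * e1)) +
    4 * e2 * (d / sigma - sigma * k2 i * e1)
    <= - (ab.1 * sigma) * (k2 i * w ^+ 2 + k2 i * e1 ^+ 2 + 2 * e2 ^+ 2)
       + ab.2 / sigma ^+ 3.
  move=> i; have [a a0 [b b0 H]] := observer_rate1 (hk1 i) (hk2 i).
  by exists (a, b).
have [a a0 Ha] := finite_lb (fun i => (Hab i).1).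
exists a => //; exists (\sum_i (ab i).2).
  by apply: sumr_ge0 => i _; exact: (Hab i).2.1.
move=> sigma e1 e2 d s0 dM; rewrite /Vobs mulr_sumr mulr_suml -big_split /=.
apply: ler_sum => i _; apply: le_trans ((Hab i).2.2 _ _ _ _ _ s0 (dM i) erefl) _.
rewrite lerD2r !mulNr lerN2 ler_wpM2r//; last by rewrite ler_wpM2r// ltW.
by rewrite !addr_ge0// mulr_ge0 ?sqr_ge0// ltW.
Qed.

(** Half of the coercivity absorbs, by Young's inequality, the coupling to w and the drift q. The
    coupling carries theta and keeps it; the drift does not, so its Young weight of order theta
    leaves 1 / theta. *)
Lemma estimator_rate (A thetabar : 'M[R]_N) :
  (2 <= N)%N -> is_adjacency A -> undirected A -> connected_graph A ->
  (forall i j, 0 < thetabar i j) ->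
  exists2 c, 0 < c & exists2 C1, 0 <= C1 & exists2 C2, 0 <= C2 &
  forall theta e w q, 0 < theta ->
    \sum_i \sum_j e i j / thetabar i j * (- (theta * thetabar i j) *
      (\sum_k A i k * (e i j - e k j) + A i j * (e i j - w j)) - q j)
    <= - (c * theta) * Vest thetabar e + C1 * theta * (\sum_j w j ^+ 2)
       + C2 / theta * (\sum_j q j ^+ 2).
Proof.
move=> hN hA hu hc tb0.
have [mu mu0 Hmu] := pinned_coercive hN hA hu hc.
have [tau tau0 Htau] := finite_ub (fun ij : 'I_N * 'I_N => (thetabar ij.1 ij.2)^-1).
have [al al0 Hal] := finite_ub (fun ij : 'I_N * 'I_N => A ij.1 ij.2).
(* The dissipation left is theta mu / 2 times the sum of squares, and [Vest] is at most tau / 2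
   times that sum. The factors N below arise because w and q depend on j only and are summed over
   i. *)
exists (mu / tau); first by rewrite divr_gt0.
exists (N%:R * (al ^+ 2 / mu)); first by rewrite mulr_ge0// divr_ge0 ?sqr_ge0// ltW.
exists (N%:R * (tau ^+ 2 / mu)); first by rewrite mulr_ge0// divr_ge0 ?sqr_ge0// ltW.
move=> theta e w q th0.
have pt i j : e i j / thetabar i j * (- (theta * thetabar i j) *
      (\sum_k A i k * (e i j - e k j) + A i j * (e i j - w j)) - q j) <=
    - theta * (e i j * (\sum_k A i k * (e i j - e k j) + A i j * e i j)) +
    theta * mu / 2 * e i j ^+ 2 + theta * (al ^+ 2 / mu) * w j ^+ 2
    + tau ^+ 2 / mu / theta * q j ^+ 2.
  move: (\sum_k _) => S; have tbij := tb0 i j.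
  have -> : e i j / thetabar i j * (- (theta * thetabar i j) *
      (S + A i j * (e i j - w j)) - q j) =
    - theta * (e i j * (S + A i j * e i j)) + theta * (e i j * (A i j * w j))
    - e i j * (q j / thetabar i j).
    by field; rewrite gt_eqF.
  have mu2 : 0 < mu / 2 by rewrite divr_gt0.
  have Y1 := young (e i j) (A i j * w j) mu2.
  have Y2 := young (e i j) (- (q j / thetabar i j)) (mulr_gt0 th0 mu2).
  have W : (A i j * w j) ^+ 2 <= al ^+ 2 * w j ^+ 2.
    rewrite exprMn ler_wpM2r ?sqr_ge0// ler_sqr ?nnegrE ?(ltW al0)//.
      exact: (Hal (i, j)).
    exact: hA.1.
  have Q : (q j / thetabar i j) ^+ 2 <= tau ^+ 2 * q j ^+ 2.
    rewrite exprMn mulrC ler_wpM2r ?sqr_ge0// ler_sqr ?nnegrE ?(ltW tau0)//.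
      exact: (Htau (i, j)).
    by rewrite invr_ge0 ltW.
  have Y1' : theta * (2 * (e i j * (A i j * w j))) <=
      theta * (mu / 2 * e i j ^+ 2 + al ^+ 2 * w j ^+ 2 / (mu / 2)).
    rewrite ler_pM2l//; apply: (le_trans Y1).
    by rewrite lerD2l ler_wpM2r// invr_ge0 ltW.
  have Y2' : 2 * (e i j * - (q j / thetabar i j)) <=
      theta * (mu / 2) * e i j ^+ 2 + tau ^+ 2 * q j ^+ 2 / (theta * (mu / 2)).
    apply: (le_trans Y2); rewrite sqrrN lerD2l ler_wpM2r// invr_ge0.
    by rewrite ltW// mulr_gt0.
  have E1 : al ^+ 2 * w j ^+ 2 / (mu / 2) = 2 * (al ^+ 2 / mu * w j ^+ 2).
    by field; rewrite gt_eqF.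
  have E2 : tau ^+ 2 * q j ^+ 2 / (theta * (mu / 2)) =
      2 * (tau ^+ 2 / mu / theta * q j ^+ 2).
    by field; rewrite !gt_eqF.
  by move: Y1' Y2'; rewrite E1 E2; lra.
apply: (@le_trans _ _ (\sum_i \sum_j
   (- theta * (e i j * (\sum_k A i k * (e i j - e k j) + A i j * e i j)) +
    theta * mu / 2 * e i j ^+ 2 + theta * (al ^+ 2 / mu) * w j ^+ 2
    + tau ^+ 2 / mu / theta * q j ^+ 2))).
  by apply: ler_sum => i _; apply: ler_sum => j _.
under eq_bigr do rewrite !big_split /= -!mulr_sumr.
have cs (x : R) : \sum_(i < N) x = N%:R * x by rewrite sumr_const card_ord mulr_natl.
rewrite !big_split /= -!mulr_sumr !cs.
have := Hmu e; set E := \sum_i \sum_j e i j ^+ 2; set Q := \sum_i \sum_j _ * _.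
move=> HE.
have VE : Vest thetabar e <= tau / 2 * E.
  rewrite /Vest /E mulr_sumr; apply: ler_sum => i _; rewrite mulr_sumr.
  apply: ler_sum => j _; rewrite mulrC ler_wpM2r ?sqr_ge0// invfM mulrC.
  by rewrite ler_wpM2r// (Htau (i, j)).
have V2 : mu / tau * theta * Vest thetabar e <= theta * mu / 2 * E.
  have -> : theta * mu / 2 * E = mu / tau * theta * (tau / 2 * E).
    by field; rewrite gt_eqF.
  by rewrite ler_wpM2l// ltW// mulr_gt0// divr_gt0.
have HE2 : theta * (mu * E) <= theta * Q by rewrite ler_wpM2l// ltW.
move: V2 HE2; set p := \sum_j w j ^+ 2; set r := \sum_j q j ^+ 2.
by lra.
Qed.

(** The hypothesis on g is strong monotonicity up to the error of evaluating at the estimates. Of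
    the decay m sum p^2, one quarter pays for the disturbance and one quarter for the estimates; the
    remaining half is m [Vact]. *)
Lemma action_rate (thetabar : 'M[R]_N) (m L : R) :
  (2 <= N)%N -> (forall i j, 0 < thetabar i j) -> 0 < m ->
  exists2 C3, 0 <= C3 & exists2 C4, 0 <= C4 &
  forall sigma p e g d, 0 < sigma -> (forall i, `|d i| <= M) ->
    m * (\sum_i p i ^+ 2) - L * (\sum_i \sum_j `|p i| * `|e i j|)
      <= \sum_i p i * g i ->
    \sum_i p i * (- g i + k1 i / k2 i * (d i / sigma)) <=
    - m * Vact p + C3 * Vest thetabar e + C4 / sigma ^+ 2.
Proof.
move=> hN tb0 m0.
have [T T0 HT] := finite_ub (fun ij : 'I_N * 'I_N => thetabar ij.1 ij.2).
have N0 : 0 < N%:R :> R by rewrite ltr0n (leq_trans _ hN).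
have NL0 : 0 <= N%:R * L ^+ 2 / m.
  by apply: divr_ge0; [apply: mulr_ge0; [exact: ltW|exact: sqr_ge0]|exact: ltW].
exists (2 * T * (N%:R * L ^+ 2 / m)).
  by rewrite mulr_ge0// mulr_ge0// ltW.
exists (\sum_i (k1 i / k2 i * M) ^+ 2 / m).
  by apply: sumr_ge0 => i _; rewrite divr_ge0 ?sqr_ge0// ltW.
move=> sigma p e g d s0 dM H.
have P1 i : p i * (k1 i / k2 i * (d i / sigma)) <=
    m / 4 * p i ^+ 2 + (k1 i / k2 i * M) ^+ 2 / m / sigma ^+ 2.
  have Y := young (p i) (k1 i / k2 i * (d i / sigma)) (divr_gt0 m0 (ltr0n R 2)).
  have D : (k1 i / k2 i * (d i / sigma)) ^+ 2 <= (k1 i / k2 i * M) ^+ 2 / sigma ^+ 2.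
    rewrite mulrA expr_div_n ler_wpM2r ?invr_ge0 ?sqr_ge0//.
    rewrite (exprMn _ _ (d i)) (exprMn _ _ M) ler_wpM2l ?sqr_ge0//.
    rewrite -[d i ^+ 2]real_normK ?num_real// ler_sqr ?nnegrE//.
    exact: le_trans (dM i).
  have : (k1 i / k2 i * (d i / sigma)) ^+ 2 / (m / 2) <=
     2 * ((k1 i / k2 i * M) ^+ 2 / m / sigma ^+ 2).
    have -> : 2 * ((k1 i / k2 i * M) ^+ 2 / m / sigma ^+ 2) =
       (k1 i / k2 i * M) ^+ 2 / sigma ^+ 2 / (m / 2).
      by field; rewrite !gt_eqF.
    by rewrite ler_wpM2r// invr_ge0 ltW// divr_gt0.
  by move: Y; lra.
have P2 i j : L * (`|p i| * `|e i j|) <=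
    m / (4 * N%:R) * p i ^+ 2 + N%:R * L ^+ 2 / m * e i j ^+ 2.
  have h0 : 0 < m / (2 * N%:R) by rewrite divr_gt0// mulr_gt0.
  have := young `|p i| (L * `|e i j|) h0.
  rewrite exprMn !real_normK ?num_real//.
  have -> : L ^+ 2 * e i j ^+ 2 / (m / (2 * N%:R)) =
     2 * (N%:R * L ^+ 2 / m * e i j ^+ 2) by field; rewrite !gt_eqF.
  have -> : m / (2 * N%:R) * p i ^+ 2 = 2 * (m / (4 * N%:R) * p i ^+ 2).
    by field; rewrite gt_eqF.
  by lra.
have S1 : \sum_i p i * (k1 i / k2 i * (d i / sigma)) <=
    m / 4 * (\sum_i p i ^+ 2) + (\sum_i (k1 i / k2 i * M) ^+ 2 / m) / sigma ^+ 2.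
  by rewrite mulr_sumr mulr_suml -big_split; apply: ler_sum => i _; exact: P1.
have S2 : L * (\sum_i \sum_j `|p i| * `|e i j|) <=
    m / 4 * (\sum_i p i ^+ 2) + N%:R * L ^+ 2 / m * (\sum_i \sum_j e i j ^+ 2).
  rewrite !mulr_sumr -big_split; apply: ler_sum => i _ /=; rewrite !mulr_sumr.
  have -> : m / 4 * p i ^+ 2 = \sum_(j < N) m / (4 * N%:R) * p i ^+ 2.
    by rewrite sumr_const card_ord -mulr_natl; field; rewrite gt_eqF.
  by rewrite -big_split; apply: ler_sum => j _; exact: P2.
have VE : \sum_i \sum_j e i j ^+ 2 <= 2 * T * Vest thetabar e.
  rewrite /Vest mulr_sumr; apply: ler_sum => i _; rewrite mulr_sumr.
  apply: ler_sum => j _; rewrite mulrA ler_pdivlMr ?mulr_gt0// mulrC.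
  by rewrite ler_wpM2r ?sqr_ge0// ler_wpM2l// (HT (i, j)).
have VE2 := ler_wpM2l NL0 VE.
have -> : Vact p = (\sum_i p i ^+ 2) / 2 by rewrite /Vact -mulr_suml.
have -> : \sum_i p i * (- g i + k1 i / k2 i * (d i / sigma)) =
    \sum_i p i * (k1 i / k2 i * (d i / sigma)) - \sum_i p i * g i.
  by rewrite -sumrB; apply: eq_bigr => i _; ring.
by move: H S1 S2 VE2; lra.
Qed.


End LyapunovRates.

(** * The cascade of Lyapunov functions *)

Ltac nonneg := repeat (first [ assumption | by [apply: ltW] | exact: ler01
  | exact: ler0n | exact: sqr_ge0 | apply: exprn_ge0 | exact: expR_ge0
  | rewrite invr_ge0 | apply: addr_ge0 | apply: mulr_ge0 ]).

Section Cascade.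
Context {R : realType}.

Lemma comparison_le (V V' : R -> R) (t0 t1 a b K : R) : 0 < a -> 0 <= b ->
  t0 <= t1 ->
  (forall t, t0 <= t <= t1 -> is_derive t 1 V (V' t)) ->
  (forall t, t0 <= t <= t1 -> V' t <= - a * V t + b) -> V t0 <= K ->
  V t1 <= expR (- a * (t1 - t0)) * K + b / a.
Proof.
move=> a0 b0 t01 dV V'le VK; apply: le_trans (comparison a0 t01 dV V'le) _.
rewrite lerD2r ler_wpM2l ?expR_ge0//.
by rewrite (le_trans _ VK)// gerBl divr_ge0// ltW.
Qed.

Lemma exp_decay_le (a t K : R) : 0 < a -> 0 <= t -> 0 <= K ->
  expR (- a * t) * K <= K.
Proof.
move=> a0 tt K0; rewrite ler_piMl// -expR0 ler_expR mulNr oppr_le0.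
by rewrite mulr_ge0// ltW.
Qed.

(** K0 + b / a bounds [Ve] for all time, and C1 / c is the gain from [Ve] to [Vn]. The drift
    constant C2 is deliberately absent: its contribution C2 / (c theta^2) is at most 1 for large
    theta, so the radius can be fixed before C2, which depends on the box. *)
Definition est_radius (a b c C1 K0 : R) : R := K0 + C1 * (K0 + b / a) / c + 2.

(* With al = 2 C3 / c and be = 2 al C1 / a the function
   Vp + (al / theta) Vn + (be / sigma) Ve decays at rate m inside the region,
   and its initial value exceeds that of Vp only by O(1 / theta + 1 / sigma). *)
Lemma cascade (a b c C1 m C2 C3 C4 K0 eps : R) :
  0 < a -> 0 <= b -> 0 < c -> 0 <= C1 -> 0 < m -> 0 <= C2 -> 0 <= C3 -> 0 <= C4 ->
  0 <= K0 -> 0 < eps -> exists2 Q, 0 < Q & forall theta sigma, Q < theta -> Q < sigma ->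
  1 <= sigma /\ exists2 T, 0 <= T &
  forall (t0 : R) (Ve Vn Vp De Dn Dp : R -> R),
  (forall t, t0 <= t -> is_derive t 1 Ve (De t)) ->
  (forall t, t0 <= t -> is_derive t 1 Vn (Dn t)) ->
  (forall t, t0 <= t -> is_derive t 1 Vp (Dp t)) ->
  (forall t, 0 <= Ve t) -> (forall t, 0 <= Vn t) -> (forall t, 0 <= Vp t) ->
  Ve t0 <= K0 -> Vn t0 <= K0 -> Vp t0 <= K0 ->
  (forall t, t0 <= t -> De t <= - (a * sigma) * Ve t + b / sigma ^+ 3) ->
  (forall t, t0 <= t -> Vp t <= K0 + 2 -> Vn t <= est_radius a b c C1 K0 ->
     Dn t <= - (c * theta) * Vn t + C1 * theta * Ve t + C2 / theta /\
     Dp t <= - m * Vp t + C3 * Vn t + C4 / sigma ^+ 2) ->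
  (forall t, t0 <= t -> Vp t <= K0 + 2 /\ Vn t <= est_radius a b c C1 K0) /\
  (forall t, t0 + T <= t -> sigma ^+ 2 * Ve t + Vn t + Vp t <= eps).
Proof.
move=> a0 b0 c0 C10 m0 C20 C30 C40 K00 eps0.
pose R2 := est_radius a b c C1 K0.
pose al := 2 * C3 / c; pose be := 2 * al * C1 / a.
have al0 : 0 <= al by nonneg.
have be0 : 0 <= be by nonneg.
pose Sm := (C4 + al * C2 + be * b) / m.
have Sm0 : 0 <= Sm by nonneg.
have ba0 : 0 <= b / a by nonneg.
(* F / Q bounds the sum of the three ultimate bounds, and takes half of eps; the transients of [Vn]
   and [Vp] take a quarter each. *)
pose F := (b / a + 1) + C1 * (b / a + 1) / c + C2 / c + Sm.
have F0 : 0 <= F.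
  by nonneg.
have mc0 : 0 <= 2 * m / c by nonneg.
have ma0 : 0 <= 2 * m / a by nonneg.
have C2c0 : 0 <= C2 / c by nonneg.
have H0 : 0 <= al * K0 + be * K0 + Sm by nonneg.
have Fe0 : 0 <= 2 * F / eps by nonneg.
(* One summand for each requirement: q <= 1, the rates c theta and a sigma at least 2 m, the drift
   of [Vn] at most 1, the excess of the weighted sum over K0 at most 1, and F / Q at most eps /
   2. *)
pose Q := 1 + 2 * m / c + 2 * m / a + C2 / c + (al * K0 + be * K0 + Sm) + 2 * F / eps.
have Q1 : 1 <= Q by rewrite /Q; lra.
have Q0 : 0 < Q by exact: lt_le_trans ltr01 Q1.
exists Q => // theta sigma Qth Qsi.
have th0 := lt_trans Q0 Qth; have si0 := lt_trans Q0 Qsi.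
split; first exact: le_trans Q1 (ltW Qsi).
pose q := Q^-1; pose h := theta^-1; pose s := sigma^-1.
have q0 : 0 < q by rewrite invr_gt0.
have h0 : 0 < h by rewrite invr_gt0.
have s0 : 0 < s by rewrite invr_gt0.
have hq : h <= q by rewrite lef_pV2 ?posrE// ltW.
have sq : s <= q by rewrite lef_pV2 ?posrE// ltW.
have q1 : q <= 1 by rewrite invf_le1.
have qX X Y : Q = X + Y -> 0 <= Y -> q * X <= 1.
  move=> QE Y0; rewrite /q mulrC ler_pdivrMr// mul1r QE lerDl.
  exact: Y0.
have qF : q * F <= eps / 2.
  have : q * (2 * F / eps) <= 1.
    by apply: (qX _ (1 + 2 * m / c + 2 * m / a + C2 / c + (al * K0 + be * K0 + Sm)));
      rewrite /Q; lra.
  rewrite mulrA ler_pdivrMr// mul1r.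
  by lra.
have qC : q * (C2 / c) <= 1.
  by apply: (qX _ (1 + 2 * m / c + 2 * m / a + (al * K0 + be * K0 + Sm) + 2 * F / eps));
     rewrite /Q; lra.
have qH : q * (al * K0 + be * K0 + Sm) <= 1.
  by apply: (qX _ (1 + 2 * m / c + 2 * m / a + C2 / c + 2 * F / eps));
     rewrite /Q; lra.
have Qmc : 2 * m <= c * theta.
  by rewrite [leRHS]mulrC -ler_pdivrMr//; apply: le_trans (ltW Qth); rewrite /Q; lra.
have Qma : 2 * m <= a * sigma.
  by rewrite [leRHS]mulrC -ler_pdivrMr//; apply: le_trans (ltW Qsi); rewrite /Q; lra.
have pw (x : R) k : 0 < x -> x <= q -> x ^+ k.+1 <= q.
  move=> x0 xq; rewrite exprS -[leRHS]mulr1 ler_pM ?exprn_ge0 ?(ltW x0)//.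
  by rewrite exprn_ile1 ?(ltW x0)// (le_trans xq).
(* The waiting times are fixed before the functions are introduced, so T serves all solutions. [Ve]
   is awaited down to order sigma^-4 because it is finally multiplied by sigma^2. *)
have [T1 [T10 HT1]] := exp_tail K0 (mulr_gt0 a0 si0) (exprn_gt0 4 s0).
have [T2 [T20 HT2]] := exp_tail R2 (mulr_gt0 c0 th0) (divr_gt0 eps0 (ltr0n R 4)).
have [T3 [T30 HT3]] := exp_tail (K0 + 1) m0 (divr_gt0 eps0 (ltr0n R 4)).
exists (T1 + T2 + T3); first by nonneg.
move=> t0 Ve Vn Vp De Dn Dp dVe dVn dVp Ve0 Vn0 Vp0 IVe IVn IVp HDe HDnp.
have ths : theta * h = 1 by rewrite divff// gt_eqF.
have sis : sigma * s = 1 by rewrite divff// gt_eqF.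
have acs : 0 < a * sigma by exact: mulr_gt0.
have cth : 0 < c * theta by exact: mulr_gt0.
have Vee t : t0 <= t -> Ve t <= expR (- (a * sigma) * (t - t0)) * K0 + b / a * s ^+ 4.
  move=> tt.
  have -> : b / a * s ^+ 4 = b / sigma ^+ 3 / (a * sigma).
    by rewrite /s; field; rewrite !gt_eqF.
  apply: (comparison_le acs _ tt _ _ IVe).
  - by nonneg.
  - by move=> r /andP[r0 _]; exact: dVe.
  - by move=> r /andP[r0 _]; exact: HDe.
have VeK t : t0 <= t -> Ve t <= K0 + b / a.
  move=> tt; apply: le_trans (Vee t tt) _; apply: lerD.
    by rewrite exp_decay_le// subr_ge0.
  by rewrite ler_piMr// (le_trans (pw _ 3%N s0 sq)).
pose region t1 := forall t, t0 <= t <= t1 -> Vp t <= K0 + 2 /\ Vn t <= R2.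
have R20 : 0 <= R2.
  by rewrite /R2 /est_radius; nonneg.
(* Used twice: from t0, with the crude bound on [Ve], to keep the region, and from t0 + T1, with the
   decayed bound, for the ultimate estimate. *)
have est_bound t1 t2 K Kn : t0 <= t1 -> t1 <= t2 -> region t2 -> 0 <= K ->
    (forall t, t1 <= t -> Ve t <= K) -> Vn t1 <= Kn ->
    Vn t2 <= expR (- (c * theta) * (t2 - t1)) * Kn + (C1 * K / c + C2 / c * h ^+ 2).
  move=> t01 t12 reg KK HK HKn.
  have -> : C1 * K / c + C2 / c * h ^+ 2 = (C1 * theta * K + C2 / theta) / (c * theta).
    by rewrite /h; field; rewrite !gt_eqF.
  apply: (comparison_le cth _ t12 _ _ HKn).
  - by nonneg.
  - by move=> r /andP[r0 _]; apply: dVn; exact: le_trans r0.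
  - move=> r /andP[r0 r2]; have r00 := le_trans t01 r0.
    have [|Vpr Vnr] := reg r; first by rewrite r00.
    have [+ _] := HDnp r r00 Vpr Vnr.
    have := ler_wpM2l (mulr_ge0 C10 (ltW th0)) (HK r r0).
    by lra.
pose Psi t := Vp t + al * h * Vn t + be * s * Ve t.
have PsiVp t : Vp t <= Psi t.
  by rewrite /Psi -addrA lerDl; nonneg.
have psi_bound t1 : t0 <= t1 -> region t1 ->
    Psi t1 <= expR (- m * (t1 - t0)) * (K0 + al * h * K0 + be * s * K0) + q * Sm.
  move=> t01 reg.
  have S1 : (C4 * s ^+ 2 + al * C2 * h ^+ 2 + be * b * s ^+ 4) / m <= q * Sm.
    rewrite /Sm [leRHS]mulrA ler_wpM2r ?invr_ge0 ?(ltW m0)//.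
    have P1 := ler_wpM2r C40 (pw _ 1%N s0 sq).
    have P2 := ler_wpM2r (mulr_ge0 al0 C20) (pw _ 1%N h0 hq).
    have P3 := ler_wpM2r (mulr_ge0 be0 b0) (pw _ 3%N s0 sq).
    by clear - P1 P2 P3; lra.
  apply: le_trans (lerD (lexx _) S1).
  pose dPsi t := Dp t + al * h * Dn t + be * s * De t.
  apply: (@comparison_le Psi dPsi) => //.
  - by nonneg.
  - move=> r /andP[r0 _]; apply: derD; last by apply: derZ; exact: dVe.
    by apply: derD; [exact: dVp|apply: derZ; exact: dVn].
  - move=> r /[dup] rr /andP[r0 _]; have [Vpr Vnr] := reg r rr.
    have [HDn HDp] := HDnp r r0 Vpr Vnr; have He := HDe r r0.
    have alh : 0 <= al * h by nonneg.
    have bes : 0 <= be * s by nonneg.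
    have Hn' : al * h * Dn r <= - (2 * C3) * Vn r + al * C1 * Ve r + al * C2 * h ^+ 2.
      apply: le_trans (ler_wpM2l alh HDn) _; rewrite le_eqVlt; apply/orP; left.
      by apply/eqP; rewrite /al /h; field; rewrite !gt_eqF.
    have He' : be * s * De r <= - (2 * al * C1) * Ve r + be * b * s ^+ 4.
      apply: le_trans (ler_wpM2l bes He) _; rewrite le_eqVlt; apply/orP; left.
      by apply/eqP; rewrite /be /s; field; rewrite !gt_eqF.
    have Hp' : C4 / sigma ^+ 2 = C4 * s ^+ 2 by rewrite /s exprVn.
    rewrite Hp' in HDp.
    (* The weighted [Vn] dissipates 2 C3 [Vn]: one half cancels the coupling in [Dp], the other
       provides decay at rate m. The factor 2 in [be] plays the same part for [Ve]. *)
    have mn : m * (al * h) * Vn r <= C3 * Vn r.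
      rewrite ler_wpM2r//.
      have -> : m * (al * h) = C3 * (2 * m / (c * theta)).
        by rewrite /al /h; field; rewrite !gt_eqF.
      by rewrite ler_piMr// ler_pdivrMr// mul1r.
    have me : m * (be * s) * Ve r <= al * C1 * Ve r.
      rewrite ler_wpM2r//.
      have -> : m * (be * s) = al * C1 * (2 * m / (a * sigma)).
        by rewrite /be /s; field; rewrite !gt_eqF.
      by rewrite ler_piMr; [|nonneg|rewrite ler_pdivrMr// mul1r].
    by rewrite /dPsi /Psi; clear - HDp Hn' He' mn me; lra.
  - have Pn := ler_wpM2l (mulr_ge0 al0 (ltW h0)) IVn.
    have Pe := ler_wpM2l (mulr_ge0 be0 (ltW s0)) IVe.
    by rewrite /Psi; clear - IVp Pn Pe; lra.
have KPsi : K0 + al * h * K0 + be * s * K0 + q * Sm <= K0 + 1.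
  have P1 := ler_wpM2r (mulr_ge0 al0 K00) hq.
  have P2 := ler_wpM2r (mulr_ge0 be0 K00) sq.
  by clear - P1 P2 qH; lra.
have KPsi0 : 0 <= K0 + al * h * K0 + be * s * K0.
  by nonneg.
have qSm : 0 <= q * Sm by nonneg.
have reg t1 : t0 <= t1 -> region t1.
  (* Both bounds are propagated together, since each differential inequality holds only while both
     are valid. *)
  pose V t := Num.max (Vp t - (K0 + 2)) (Vn t - R2).
  have VP t r : (V t <= r) = (Vp t - (K0 + 2) <= r) && (Vn t - R2 <= r).
    by rewrite ge_max.
  have Vle t : t0 <= t -> V t <= 0.
    apply: trapped.
    - move=> r r0; apply: continuous_max; apply: cvgB; try exact: cvg_cst.
        exact: der_cont (dVp r r0).
      exact: der_cont (dVn r r0).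
    - rewrite VP !subr_le0; apply/andP; split; first by clear - IVp; lra.
      apply: le_trans IVn _; by rewrite /R2 /est_radius -addrA lerDl; nonneg.
    - move=> r r0 HV.
      have regr : region r.
        by move=> u ur; have := HV u ur; rewrite VP !subr_le0 => /andP.
      rewrite gt_max !subr_lt0; apply/andP; split.
        apply: le_lt_trans (PsiVp r) _; apply: le_lt_trans (psi_bound r r0 regr) _.
        have := @exp_decay_le m (r - t0) _ m0 _ KPsi0; rewrite subr_ge0 => /(_ r0).
        by clear - KPsi; lra.
      have KK : 0 <= K0 + b / a by nonneg.
      apply: le_lt_trans (est_bound t0 r _ _ (lexx _) r0 regr KK VeK IVn) _.
      have := @exp_decay_le (c * theta) (r - t0) _ cth _ K00; rewrite subr_ge0.
      move=> /(_ r0); have := ler_wpM2l C2c0 (pw _ 1%N h0 hq).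
      by rewrite /R2 /est_radius; clear - qC; lra.
  move=> t01 t /andP[tt _]; have := Vle t tt.
  by rewrite VP !subr_le0 => /andP.
split=> [t tt|t Tt]; first by apply: (reg t tt); rewrite tt lexx.
have tt1 : t0 + T1 <= t by clear - Tt T20 T30; lra.
have tt : t0 <= t by clear - tt1 T10; lra.
have t01 : t0 <= t0 + T1 by rewrite lerDl.
have VeT r : t0 + T1 <= r -> Ve r <= (b / a + 1) * s ^+ 4.
  move=> rT; have rt : t0 <= r by exact: le_trans rT.
  apply: le_trans (Vee r rt) _; rewrite mulrDl mul1r addrC lerD2l.
  by apply: HT1; rewrite lerBrDl.
have ba1 : 0 <= b / a + 1 by nonneg.
have B1 : sigma ^+ 2 * Ve t <= (b / a + 1) * q.
  apply: le_trans (ler_wpM2l (sqr_ge0 _) (VeT t tt1)) _.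
  have -> : sigma ^+ 2 * ((b / a + 1) * s ^+ 4) = (b / a + 1) * s ^+ 2.
    by rewrite /s; field; rewrite !gt_eqF.
  by rewrite ler_wpM2l// pw.
have B2 : Vn t <= eps / 4 + (C1 * (b / a + 1) / c + C2 / c) * q.
  have KK : 0 <= (b / a + 1) * s ^+ 4 by nonneg.
  have Kn : Vn (t0 + T1) <= R2.
    by apply: (reg _ t01 _ _).2; rewrite t01 lexx.
  apply: le_trans (est_bound _ _ _ _ t01 tt1 (reg t tt) KK VeT Kn) _.
  apply: lerD; first by apply: HT2; clear - Tt T30; lra.
  have P1 := ler_wpM2l C2c0 (pw _ 1%N h0 hq).
  have Cc : 0 <= C1 * (b / a + 1) / c by nonneg.
  have P2 := ler_wpM2l Cc (pw _ 3%N s0 sq).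
  by clear - P1 P2; lra.
have B3 : Vp t <= eps / 4 + q * Sm.
  apply: le_trans (PsiVp t) _; apply: le_trans (psi_bound t tt (reg t tt)) _.
  rewrite lerD2r; apply: le_trans (HT3 (t - t0) _); last by clear - Tt T10 T20; lra.
  by rewrite ler_wpM2l ?expR_ge0//; clear - KPsi qSm; lra.
by rewrite /F in qF; clear - B1 B2 B3 qF; lra.
Qed.

End Cascade.

(** * The closed loop *)

Section ErrorNorm.
Context {R : realType} {N : nat}.

Lemma sum_mxvec (B : 'M[R]_N) :
  \sum_k mxvec B 0 k ^+ 2 = \sum_i \sum_j B i j ^+ 2.
Proof.
rewrite pair_bigA (reindex _ (curry_mxvec_bij N N)) /=.
by apply: eq_bigr => -[i j] _ /=; rewrite mxvecE.
Qed.

Lemma norm2_error (d : 'I_N -> R -> R) xs t (s : state R N) :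
  norm2 (error d xs t s) ^+ 2 =
    \sum_i (act s 0 i - xhat s 0 i) ^+ 2 + \sum_i (d i t - zhat s 0 i) ^+ 2 +
    (\sum_i \sum_j (est s i j - act s 0 j) ^+ 2 + \sum_i (act s 0 i - xs 0 i) ^+ 2).
Proof.
rewrite /norm2 sqr_sqrtr; last by apply: sumr_ge0 => i _; exact: sqr_ge0.
rewrite big_split_ord; congr (_ + _).
  rewrite big_split_ord; congr (_ + _); apply: eq_bigr => i _.
    by rewrite row_mxEl row_mxEl !mxE.
  by rewrite row_mxEl row_mxEr !mxE.
rewrite big_split_ord; congr (_ + _).
  under eq_bigr do rewrite row_mxEr row_mxEl.
  by rewrite sum_mxvec; do 2![apply: eq_bigr => ? _]; rewrite !mxE.
by apply: eq_bigr => i _; rewrite row_mxEr row_mxEr !mxE.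
Qed.

Lemma norm2_le (d : 'I_N -> R -> R) xs t s v : 0 <= v ->
  norm2 (error d xs t s) ^+ 2 <= v ^+ 2 -> norm2 (error d xs t s) <= v.
Proof. by move=> v0; rewrite ler_sqr ?nnegrE ?sqrtr_ge0. Qed.

Lemma error_components (d : 'I_N -> R -> R) xs t (s : state R N) v :
  norm2 (error d xs t s) <= v ->
  [/\ forall i, `|act s 0 i - xhat s 0 i| <= v,
      forall i, `|d i t - zhat s 0 i| <= v,
      forall i j, `|est s i j - act s 0 j| <= v
    & forall i, `|act s 0 i - xs 0 i| <= v].
Proof.
move=> H; have n0 : 0 <= norm2 (error d xs t s) by exact: sqrtr_ge0.
have v0 := le_trans n0 H.
have le_v (x : R) : x ^+ 2 <= norm2 (error d xs t s) ^+ 2 -> `|x| <= v.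
  move=> xle; apply: le_trans H; rewrite -ler_sqr ?nnegrE//.
  by rewrite real_normK ?num_real.
have sq (I : finType) (F : I -> R) i : F i ^+ 2 <= \sum_j F j ^+ 2.
  by apply: (le_sum_term (a := fun j => F j ^+ 2)) => j; exact: sqr_ge0.
have s0 (I : finType) (F : I -> R) : 0 <= \sum_j F j ^+ 2.
  by apply: sumr_ge0 => i _; exact: sqr_ge0.
have s00 (F : 'I_N -> 'I_N -> R) : 0 <= \sum_i \sum_j F i j ^+ 2.
  by apply: sumr_ge0 => i _; exact: s0.
split=> [i|i|i j|i]; apply: le_v; rewrite norm2_error.
- apply: le_trans (sq _ (fun i => act s 0 i - xhat s 0 i) i) _.
  by rewrite -addrA lerDl !addr_ge0.
- apply: le_trans (sq _ (fun i => d i t - zhat s 0 i) i) _.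
  by rewrite [X in X + _]addrC -addrA lerDl !addr_ge0.
- apply: le_trans (sq _ (fun j => est s i j - act s 0 j) j) _.
  apply: le_trans (le_sum_term (a := fun i => \sum_j (est s i j - act s 0 j) ^+ 2) i _) _.
    by move=> k; exact: s0.
  by rewrite addrCA lerDl !addr_ge0.
- apply: le_trans (sq _ (fun i => act s 0 i - xs 0 i) i) _.
  by rewrite addrA lerDr !addr_ge0.
Qed.

End ErrorNorm.

(** * Derivatives and comparison bounds for the Lyapunov functions *)

Section LyapunovDerivatives.
Context {R : realType} {N : nat}.
Implicit Types (e : 'I_N -> 'I_N -> R -> R) (p : 'I_N -> R -> R).

Lemma der_Vobs (k1 k2 : 'I_N -> R) p q (p' q' : 'I_N -> R) (t : R) :
  (forall i, is_derive t 1 (p i) (p' i)) ->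
  (forall i, is_derive t 1 (q i) (q' i)) ->
  is_derive t 1 (fun t => Vobs k1 k2 (p ^~ t) (q ^~ t))
    (\sum_i (2 * k2 i * (p i t - k1 i / k2 i * q i t) * (p' i - k1 i / k2 i * q' i) +
       2 * k2 i * p i t * p' i + 4 * q i t * q' i)).
Proof.
move=> dp dq; apply: der_sum => i.
have H := derD (derD (derZ (k2 i) (der_sqr (derB (dp i) (derZ (k1 i / k2 i) (dq i)))))
  (derZ (k2 i) (der_sqr (dp i)))) (derZ 2 (der_sqr (dq i))).
by apply: (is_derive_eq H); ring.
Qed.

Lemma der_Vest (tb : 'M[R]_N) e (e' : 'I_N -> 'I_N -> R) (t : R) :
  (forall i j, tb i j != 0) ->
  (forall i j, is_derive t 1 (e i j) (e' i j)) ->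
  is_derive t 1 (fun t => Vest tb (fun i j => e i j t))
    (\sum_i \sum_j e i j t / tb i j * e' i j).
Proof.
move=> tb0 de; apply: der_sum => i; apply: der_sum => j.
have := derZ (2 * tb i j)^-1 (der_sqr (de i j)).
have -> : (2 * tb i j)^-1 * (2 * e i j t * e' i j) = e i j t / tb i j * e' i j.
  by field; rewrite tb0.
have -> // : (fun s => (2 * tb i j)^-1 * e i j s ^+ 2) =
  (fun s => e i j s ^+ 2 / (2 * tb i j)).
by apply/funext => s; rewrite mulrC.
Qed.

Lemma der_Vact p (p' : 'I_N -> R) (t : R) :
  (forall i, is_derive t 1 (p i) (p' i)) ->
  is_derive t 1 (fun t => Vact (p ^~ t)) (\sum_i p i t * p' i).
Proof.
move=> dp; apply: der_sum => i.
have := derZ 2^-1 (der_sqr (dp i)).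
have -> : 2^-1 * (2 * p i t * p' i) = p i t * p' i by field.
have -> // : (fun s => 2^-1 * p i s ^+ 2) = (fun s => p i s ^+ 2 / 2).
by apply/funext => s; rewrite mulrC.
Qed.

Lemma Vobs_ge0 (k1 k2 e1 e2 : 'I_N -> R) : (forall i, 0 < k2 i) ->
  0 <= Vobs k1 k2 e1 e2.
Proof.
move=> h; apply: sumr_ge0 => i _.
by rewrite !addr_ge0// mulr_ge0 ?sqr_ge0// ltW.
Qed.

Lemma Vest_ge0 (tb : 'M[R]_N) (e : 'I_N -> 'I_N -> R) : (forall i j, 0 < tb i j) -> 0 <= Vest tb e.
Proof.
move=> h; apply: sumr_ge0 => i _; apply: sumr_ge0 => j _.
by rewrite divr_ge0 ?sqr_ge0// mulr_ge0// ltW.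
Qed.

Lemma Vact_ge0 (p : 'I_N -> R) : 0 <= Vact p.
Proof. by apply: sumr_ge0 => i _; rewrite divr_ge0 ?sqr_ge0. Qed.

Lemma Vobs_bounds (k1 k2 : 'I_N -> R) : (forall i, 0 < k2 i) ->
  exists2 K : R, 0 < K & forall e1 e2 : 'I_N -> R,
  [/\ \sum_i (e1 i - k1 i / k2 i * e2 i) ^+ 2 <= K * Vobs k1 k2 e1 e2,
      \sum_i e1 i ^+ 2 <= K * Vobs k1 k2 e1 e2
    & \sum_i e2 i ^+ 2 <= Vobs k1 k2 e1 e2].
Proof.
move=> h; have [K K0 HK] := finite_ub (fun i => (k2 i)^-1).
have k2sq i (x : R) : x ^+ 2 <= K * (k2 i * x ^+ 2).
  rewrite mulrA ler_peMl ?sqr_ge0// -ler_pdivrMr// div1r; exact: HK.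
exists K => // e1 e2; rewrite /Vobs mulr_sumr.
have p0 i (x : R) : 0 <= k2 i * x ^+ 2 by rewrite mulr_ge0 ?sqr_ge0// ltW.
have q0 i (x : R) : 0 <= K * (k2 i * x ^+ 2) by rewrite mulr_ge0// ltW.
split; apply: ler_sum => i _.
- apply: le_trans (k2sq i _) _; rewrite ler_wpM2l ?(ltW K0)// -addrA lerDl.
  by rewrite addr_ge0// mulr_ge0 ?sqr_ge0.
- apply: le_trans (k2sq i _) _; rewrite ler_wpM2l ?(ltW K0)//.
  by rewrite addrAC lerDr addr_ge0// mulr_ge0 ?sqr_ge0.
- apply: (@le_trans _ _ (2 * e2 i ^+ 2)); last by rewrite lerDr addr_ge0.
  by rewrite ler_peMl ?sqr_ge0// ler1n.
Qed.

Lemma Vest_term (tb : 'M[R]_N) (e : 'I_N -> 'I_N -> R) i j :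
  (forall i j, 0 < tb i j) -> e i j ^+ 2 <= 2 * tb i j * Vest tb e.
Proof.
move=> h; rewrite -ler_pdivrMl ?mulr_gt0// mulrC.
have h0 k l : 0 <= e k l ^+ 2 / (2 * tb k l).
  by rewrite divr_ge0 ?sqr_ge0// mulr_ge0// ltW.
apply: le_trans (le_sum_term (a := fun j => e i j ^+ 2 / (2 * tb i j)) j _) _ => //.
apply: (le_sum_term (a := fun i => \sum_j e i j ^+ 2 / (2 * tb i j))) => k.
by apply: sumr_ge0.
Qed.

Lemma Vact_term (p : 'I_N -> R) i : p i ^+ 2 <= 2 * Vact p.
Proof.
rewrite mulrC -ler_pdivrMr//.
by apply: (le_sum_term (a := fun i => p i ^+ 2 / 2)) => k; rewrite divr_ge0 ?sqr_ge0.
Qed.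

(** A crude bound free of square roots; it suffices for choosing the radius of a box. *)
Lemma le_1Dsqr (x y : R) : x ^+ 2 <= y -> `|x| <= 1 + y.
Proof.
move=> H; have [x0|x0] := ler0P x.
  by have := sqr_ge0 (x + 1); rewrite sqrrD; move: H; lra.
by have := sqr_ge0 (x - 1); rewrite sqrrB; move: H; lra.
Qed.

End LyapunovDerivatives.

(** * Reduced coordinates and the ultimate bound *)

Section MainEstimate.
Context {R : realType} {N : nat}.
Variables (f : 'I_N -> 'rV[R]_N -> R) (A : 'M[R]_N) (t0 : R) (d : 'I_N -> R -> R).
Variables (thetabar : 'M[R]_N) (k1 k2 : 'I_N -> R) (xs : 'rV[R]_N).
Hypothesis hN : (2 <= N)%N.
Hypothesis hthetabar : forall i j, 0 < thetabar i j.
Hypotheses (hk1 : forall i, 0 < k1 i) (hk2 : forall i, 0 < k2 i).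
Hypotheses (hf : forall i, C2 (f i)) (hmono : strongly_monotone (pseudogradient f)).
Hypotheses (hA : is_adjacency A) (hundirected : undirected A).
Hypotheses (hconnected : connected_graph A) (hd : forall i, C1_bounded_from t0 (d i)).
Hypothesis hxs : nash_equilibrium f xs.

(* The feedback G is either the family of partial derivatives or its truncation
   to a box, which is globally Lipschitz. *)
Definition loop_for (G : 'I_N -> 'rV[R]_N -> R) (theta sigma : R)
    (s : R -> state R N) : Prop :=
  forall t, t0 <= t ->
  [/\ forall i, deriv_from t0 (fun r => act (s r) 0 i) t
        (- G i (row i (est (s t))) - zhat (s t) 0 i + d i t),
      forall i j, deriv_from t0 (fun r => est (s r) i j) t
        (- (theta * thetabar i j) * consensus_error A (s t) i j),
      forall i, deriv_from t0 (fun r => xhat (s r) 0 i) t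
        (- G i (row i (est (s t))) - zhat (s t) 0 i + zhat (s t) 0 i +
         sigma * k1 i * (act (s t) 0 i - xhat (s t) 0 i))
    & forall i, deriv_from t0 (fun r => zhat (s r) 0 i) t
        (sigma ^+ 2 * k2 i * (act (s t) 0 i - xhat (s t) 0 i))].

Lemma disturbance_bound : exists (d' : 'I_N -> R -> R) (M : R),
  [/\ 0 < M, forall i t, t0 <= t -> deriv_from t0 (d i) t (d' i t)
    & forall i t, t0 <= t -> `|d' i t| <= M].
Proof.
have /choice[dM HdM] : forall i, exists dM : (R -> R) * R,
    (forall t, t0 <= t -> deriv_from t0 (d i) t (dM.1 t)) /\
    (forall t, t0 <= t -> `|dM.1 t| <= dM.2).
  by move=> i; have [g' [dg _ [M HM]]] := hd i; exists (g', M).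
have [M M0 HM] := finite_ub (fun i => (dM i).2).
exists (fun i => (dM i).1), M; split=> // i t tt; first exact: (HdM i).1.
by apply: le_trans (HM i); exact: (HdM i).2.
Qed.

(** Strong monotonicity between xs + p and xs, where the pseudogradient vanishes by
    [nash_stationary]. *)
Lemma monotone_at_equilibrium : exists2 m, 0 < m & forall p : 'rV[R]_N,
  m * (\sum_i p 0 i ^+ 2) <= \sum_i p 0 i * partial i (f i) (xs + p).
Proof.
have [m m0 Hm] := hmono; exists m => // p.
have := Hm (xs + p) xs; rewrite addrAC subrr add0r.
rewrite /norm2 sqr_sqrtr; last by apply: sumr_ge0 => i _; exact: sqr_ge0.
move=> H; apply: le_trans H _; rewrite mxE le_eqVlt; apply/orP; left; apply/eqP.
apply: eq_bigr => i _; rewrite !mxE (nash_stationary _ hxs) ?subr0//.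
exact: (hf i).1.1.
Qed.

Lemma partial_box (rho : R) : exists L B, [/\ 0 <= L, 0 <= B,
  forall i x, box rho x -> `|partial i (f i) x| <= B
  & forall i x y, box rho x -> box rho y ->
    `|partial i (f i) x - partial i (f i) y| <= L * \sum_j `|x 0 j - y 0 j|].
Proof.
have /choice[Lf HL] := fun i => lipschitz_box rho ((hf i).2 i).
have /choice[Bf HB] := fun i => bounded_box rho ((hf i).1.2 i).
have [L L0 Lle] := finite_ub Lf; have [B B0 Ble] := finite_ub Bf.
exists L, B; split; [exact: ltW|exact: ltW| |] => [i x bx|i x y bx by_].
  by apply: le_trans (Ble i); exact: (HB i).2.
apply: le_trans ((HL i).2 _ _ bx by_) _; rewrite ler_wpM2r//.
by apply: sumr_ge0 => j _; exact: normr_ge0.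
Qed.

(* The combination w is chosen so that p does not see zeta_2, whose transient is
   of order sigma. *)
Lemma reduced_coordinates G theta sigma (s : R -> state R N) (d' : 'I_N -> R -> R) :
  0 < sigma -> loop_for G theta sigma s ->
  (forall i t, t0 <= t -> deriv_from t0 (d i) t (d' i t)) ->
  exists (e1 e2 p : 'I_N -> R -> R) (e : 'I_N -> 'I_N -> R -> R),
  let w i t := e1 i t - k1 i / k2 i * e2 i t in
  let q i t := - G i (row i (est (s t))) + k1 i / k2 i * (d' i t / sigma) in
  forall t, t0 <= t ->
  [/\ forall i, is_derive t 1 (e1 i) (sigma * (e2 i t - k1 i * e1 i t)),
      forall i, is_derive t 1 (e2 i) (d' i t / sigma - sigma * k2 i * e1 i t),
      forall i, is_derive t 1 (p i) (q i t)
    & forall i j, is_derive t 1 (e i j) (- (theta * thetabar i j) *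
        (\sum_k A i k * (e i j t - e k j t) + A i j * (e i j t - w j t)) - q j t)] /\
  [/\ forall i, e1 i t = act (s t) 0 i - xhat (s t) 0 i,
      forall i, e2 i t = (d i t - zhat (s t) 0 i) / sigma,
      forall i, p i t = act (s t) 0 i - xs 0 i - w i t
    & forall i j, e i j t = est (s t) i j - act (s t) 0 j + w j t].
Proof.
move=> s0 Hs Hd'.
have HX0 i t (tt : t0 <= t) := let: And4 h _ _ _ := Hs t tt in h i.
have HY0 ij t (tt : t0 <= t) := let: And4 _ h _ _ := Hs t tt in h ij.1 ij.2.
have HXh0 i t (tt : t0 <= t) := let: And4 _ _ h _ := Hs t tt in h i.
have HZh0 i t (tt : t0 <= t) := let: And4 _ _ _ h := Hs t tt in h i.
(* The components of s and d are replaced by extensions that are differentiable in the two-sided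
   sense at t0; they agree with the originals from t0 on. *)
have /choice[X HX] := fun i => deriv_from_extension (HX0 i).
have /choice[Y HY] := fun ij : 'I_N * 'I_N => deriv_from_extension (HY0 ij).
have /choice[Xh HXh] := fun i => deriv_from_extension (HXh0 i).
have /choice[Zh HZh] := fun i => deriv_from_extension (HZh0 i).
have /choice[D HD] := fun i => deriv_from_extension (Hd' i).
pose e1 i t := X i t - Xh i t.
pose e2 i t := sigma^-1 * (D i t - Zh i t).
pose w i t := e1 i t - k1 i / k2 i * e2 i t.
pose p i t := X i t - w i t - xs 0 i.
pose e i j t := Y (i, j) t - (X j t - w j t).
exists e1, e2, p, e => w' q t tt.
have XE i := (HX i).1 t tt; have YE i j := (HY (i, j)).1 t tt.
have XhE i := (HXh i).1 t tt; have ZhE i := (HZh i).1 t tt.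
have DE i := (HD i).1 t tt.
have k20 i : k2 i != 0 by rewrite gt_eqF.
have si0 : sigma != 0 by rewrite gt_eqF.
have de1 i : is_derive t 1 (e1 i) (sigma * (e2 i t - k1 i * e1 i t)).
  apply: (is_derive_eq (derB ((HX i).2 t tt) ((HXh i).2 t tt))).
  by rewrite /e1 /e2 XE XhE ZhE DE; field.
have de2 i : is_derive t 1 (e2 i) (d' i t / sigma - sigma * k2 i * e1 i t).
  apply: (is_derive_eq (derZ sigma^-1 (derB ((HD i).2 t tt) ((HZh i).2 t tt)))).
  by rewrite /e1 XE XhE; field.
(* Both x and w have the term sigma e2 in their derivatives; it cancels in the difference. *)
have dchi i : is_derive t 1 (fun t => X i t - w i t) (q i t).
  apply: (is_derive_eq (derB ((HX i).2 t tt) (derB (de1 i) (derZ (k1 i / k2 i) (de2 i))))).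
  by rewrite /q /e2 ZhE DE; field; rewrite ?k20 ?si0.
split; split=> //.
- by move=> i; apply: (is_derive_eq (derB (dchi i) (derC (xs 0 i) t))); rewrite subr0.
- move=> i j; apply: (is_derive_eq (derB ((HY (i, j)).2 t tt) (dchi j))) => /=.
  congr (_ * (_ + _ * _) - _).
    by apply: eq_bigr => k _; rewrite /e !YE; ring.
  by rewrite /e YE XE /w' -/(w j t); ring.
- by move=> i; rewrite /e1 XE XhE.
- by move=> i; rewrite /e2 DE ZhE mulrC.
- by move=> i; rewrite /p XE /w' -/(w i t); ring.
- by move=> i j; rewrite /e YE XE /w' -/(w j t); ring.
Qed.

Lemma sqr_le_bound (x y : R) : `|x| <= y -> x ^+ 2 <= y ^+ 2.
Proof.
move=> xy; rewrite -[x ^+ 2]real_normK ?num_real// ler_sqr ?nnegrE//.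
exact: le_trans xy.
Qed.

(** For sigma >= 1 the scaled error e2 is bounded by v1, hence w i by [W i], and K0 is independent
    of sigma. *)
Lemma initial_bounds (v1 : R) : 0 < v1 -> exists2 K0, 0 <= K0 &
  forall sigma (z1 z2 xi : 'I_N -> R) (eta : 'I_N -> 'I_N -> R), 1 <= sigma ->
  (forall i, `|z1 i| <= v1) -> (forall i, `|z2 i| <= v1) ->
  (forall i j, `|eta i j| <= v1) -> (forall i, `|xi i| <= v1) ->
  forall e2 w : 'I_N -> R,
  (forall i, e2 i = z2 i / sigma) -> (forall i, w i = z1 i - k1 i / k2 i * e2 i) ->
  [/\ Vobs k1 k2 z1 e2 <= K0, Vest thetabar (fun i j => eta i j + w j) <= K0
    & Vact (fun i => xi i - w i) <= K0].
Proof.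
move=> v10; pose W i := (1 + k1 i / k2 i) * v1.
pose Ka := \sum_i (k2 i * W i ^+ 2 + k2 i * v1 ^+ 2 + 2 * v1 ^+ 2).
pose Kb := \sum_i \sum_j (v1 + W j) ^+ 2 / (2 * thetabar i j).
pose Kc := \sum_i (v1 + W i) ^+ 2 / 2.
have Ka0 : 0 <= Ka.
  apply: sumr_ge0 => i _; have := hk2 i => /ltW ?.
  by rewrite !addr_ge0// mulr_ge0// sqr_ge0.
have Kb0 : 0 <= Kb.
  apply: sumr_ge0 => i _; apply: sumr_ge0 => j _.
  by rewrite divr_ge0 ?sqr_ge0// mulr_ge0// ltW.
have Kc0 : 0 <= Kc by apply: sumr_ge0 => i _; rewrite divr_ge0 ?sqr_ge0.
exists (Ka + Kb + Kc) => [|sigma z1 z2 xi eta s1 Hz1 Hz2 Heta Hxi e2 w e2E wE].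
  by rewrite !addr_ge0.
have He2 i : `|e2 i| <= v1.
  have s0 : 0 < sigma by exact: lt_le_trans s1.
  rewrite e2E normrM normfV (gtr0_norm s0) ler_pdivrMr//.
  by apply: le_trans (Hz2 i) _; rewrite ler_peMr// ltW.
have Hw i : `|w i| <= W i.
  have r0 : 0 < k1 i / k2 i by rewrite divr_gt0.
  rewrite wE /W mulrDl mul1r (le_trans (ler_normB _ _))// lerD//.
  by rewrite normrM (gtr0_norm r0) ler_pM2l.
have bVobs : Vobs k1 k2 z1 e2 <= Ka.
  apply: ler_sum => i _; rewrite -wE; have k20 := ltW (hk2 i).
  have H1 := ler_wpM2l k20 (sqr_le_bound (Hw i)).
  have H2 := ler_wpM2l k20 (sqr_le_bound (Hz1 i)).
  have H3 := sqr_le_bound (He2 i).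
  by move: H1 H2 H3; lra.
have bVest : Vest thetabar (fun i j => eta i j + w j) <= Kb.
  apply: ler_sum => i _; apply: ler_sum => j _.
  rewrite ler_wpM2r ?invr_ge0 ?mulr_ge0 ?(ltW (hthetabar i j))//.
  by apply: sqr_le_bound; rewrite (le_trans (ler_normD _ _))// lerD.
have bVact : Vact (fun i => xi i - w i) <= Kc.
  apply: ler_sum => i _; rewrite ler_wpM2r//.
  by apply: sqr_le_bound; rewrite (le_trans (ler_normB _ _))// lerD.
by split; [apply: le_trans bVobs _|apply: le_trans bVest _|apply: le_trans bVact _]; lra.
Qed.

(** The way back to the original errors: z2 = sigma e2 forces the factor sigma^2, and eta and xi are
    recovered by undoing the shift by w, which [Vobs] controls. *)
Lemma error_bound : exists2 C, 0 < C & forall sigma (z1 z2 xi : 'I_N -> R)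
  (eta : 'I_N -> 'I_N -> R) (e2 w : 'I_N -> R), 1 <= sigma ->
  (forall i, e2 i = z2 i / sigma) -> (forall i, w i = z1 i - k1 i / k2 i * e2 i) ->
  \sum_i z1 i ^+ 2 + \sum_i z2 i ^+ 2 +
    (\sum_i \sum_j eta i j ^+ 2 + \sum_i xi i ^+ 2) <=
  C * (sigma ^+ 2 * Vobs k1 k2 z1 e2 + Vest thetabar (fun i j => eta i j + w j)
       + Vact (fun i => xi i - w i)).
Proof.
have [K K0 HK] := Vobs_bounds k1 hk2.
have [T T0 HT] := finite_ub (fun ij : 'I_N * 'I_N => thetabar ij.1 ij.2).
have N0 : 0 <= N%:R :> R by rewrite ler0n.
(* The terms K, 1, 2 N K and 2 K come from z1, z2 and the shift by w in eta and in xi; 4 T and 4 are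
   the coefficients of [Vest] and [Vact]. *)
pose C := (K + 1 + 2 * N%:R * K + 2 * K) + 4 * T + 4.
have C10 : 0 <= K + 1 + 2 * N%:R * K + 2 * K.
  by have := mulr_ge0 N0 (ltW K0); move: K0; lra.
exists C; first by rewrite /C; move: T0; lra.
move=> sigma z1 z2 xi eta e2 w s1 e2E wE.
have [Hw0 Hz1 He2] := HK z1 e2.
have Hw : \sum_j w j ^+ 2 <= K * Vobs k1 k2 z1 e2.
  by under eq_bigr do rewrite wE.
set Ve := Vobs _ _ _ _ in Hw0 Hw Hz1 He2 *; set Vn := Vest _ _; set Vp := Vact _.
have Ve0 : 0 <= Ve by exact: Vobs_ge0.
have Vn0 : 0 <= Vn by exact: Vest_ge0.
have Vp0 : 0 <= Vp by exact: Vact_ge0.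
have s0 : 0 < sigma by exact: lt_le_trans s1.
have Hz2 : \sum_i z2 i ^+ 2 <= sigma ^+ 2 * Ve.
  apply: le_trans (ler_wpM2l (sqr_ge0 sigma) He2).
  rewrite mulr_sumr le_eqVlt; apply/orP; left; apply/eqP.
  by apply: eq_bigr => i _; rewrite e2E; field; rewrite gt_eqF.
have Vs : Ve <= sigma ^+ 2 * Ve by rewrite ler_peMl// exprn_ege1.
have two (x y : R) : x ^+ 2 <= 2 * (x + y) ^+ 2 + 2 * y ^+ 2.
  rewrite -subr_ge0; have -> : 2 * (x + y) ^+ 2 + 2 * y ^+ 2 - x ^+ 2 =
    (x + 2 * y) ^+ 2 by ring.
  exact: sqr_ge0.
have Heta : \sum_i \sum_j eta i j ^+ 2 <= 4 * T * Vn + 2 * N%:R * (\sum_j w j ^+ 2).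
  have -> : 2 * N%:R * (\sum_j w j ^+ 2) = \sum_(i < N) 2 * \sum_j w j ^+ 2.
    by rewrite sumr_const card_ord -[RHS]mulr_natl; ring.
  rewrite /Vn /Vest [4 * T * _]mulr_sumr -big_split; apply: ler_sum => i _ /=.
  rewrite !mulr_sumr -big_split; apply: ler_sum => j _ /=.
  apply: le_trans (two _ (w j)) _; rewrite lerD2r.
  rewrite [leRHS]mulrA ler_pdivlMr ?mulr_gt0//.
  have -> : 2 * (eta i j + w j) ^+ 2 * (2 * thetabar i j) =
    4 * thetabar i j * (eta i j + w j) ^+ 2 by ring.
  by rewrite ler_wpM2r ?sqr_ge0// ler_wpM2l// (HT (i, j)).
have Hxi : \sum_i xi i ^+ 2 <= 4 * Vp + 2 * (\sum_j w j ^+ 2).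
  rewrite /Vp /Vact !mulr_sumr -big_split; apply: ler_sum => i _ /=.
  by have := two (xi i) (- w i); rewrite sqrrN; lra.
have N1 := ler_wpM2l N0 Hw.
have P1 := ler_wpM2l C10 Vs.
have T40 : 0 <= 4 * T + 4 by move: T0; lra.
have P2 := mulr_ge0 T40 (le_trans Ve0 Vs).
have P3 := mulr_ge0 C10 Vn0; have P4 := mulr_ge0 C10 Vp0.
have P5 := mulr_ge0 (ltW T0) Vp0.
have KN := mulr_ge0 (mulr_ge0 N0 (ltW K0)) (le_trans Ve0 Vs).
have KV := mulr_ge0 (ltW K0) (le_trans Ve0 Vs).
have K1 := ler_wpM2l (ltW K0) Vs.
have K2 := ler_wpM2l (mulr_ge0 N0 (ltW K0)) Vs.
move: Hz1 Hz2 Heta Hxi Hw N1 P1 P2 P3 P4 P5 KN KV K1 K2 Vn0 Vp0 Ve0 Vs.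
rewrite /C; set S := sigma ^+ 2 * Ve; set Sw := \sum_j w j ^+ 2.
by lra.
Qed.


(* rho bounds the states in the invariant region; it depends on v1 only, so the
   Lipschitz constants on the box can enter Q. *)
Lemma main_estimate (v1 v2 : R) : 0 < v1 -> 0 < v2 ->
  exists rho Q : R, [/\ 0 <= rho, 0 < Q &
  forall theta sigma, Q < theta -> Q < sigma -> exists2 T, t0 <= T &
  forall (G : 'I_N -> 'rV[R]_N -> R) (s : R -> state R N),
    (forall i x, box rho x -> G i x = partial i (f i) x) ->
    loop_for G theta sigma s ->
    norm2 (error d xs t0 (s t0)) <= v1 ->
    (forall t, t0 <= t -> forall i, box rho (row i (est (s t)))) /\
    (forall t, T <= t -> norm2 (error d xs t (s t)) <= v2)].
Proof.
move=> v10 v20.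
have [d' [M [M0 dd dM]]] := disturbance_bound.
have [m m0 Hmono] := monotone_at_equilibrium.
have [a a0 [b b0 Hobs]] := @observer_rate R N k1 k2 M hk1 hk2.
have [c c0 [C1 C10 [C2 C20 Hest]]] :=
  estimator_rate hN hA hundirected hconnected hthetabar.
have [K K0 HK] := Vobs_bounds k1 hk2.
have [TB TB0 HTB] := finite_ub (fun ij : 'I_N * 'I_N => thetabar ij.1 ij.2).
have [X X0 HX] := finite_ub (fun j => `|xs 0 j|).
have [I0 I00 Hinit] := initial_bounds v10.
have [CE CE0 HCE] := error_bound.
have CK0 : 0 <= C1 * K by rewrite mulr_ge0// ltW.
pose R2 := est_radius a b c (C1 * K) I0.
have R20 : 0 <= R2.
  rewrite /R2 /est_radius; have ba : 0 <= b / a by rewrite divr_ge0// ltW.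
  by rewrite !addr_ge0// divr_ge0 ?mulr_ge0 ?addr_ge0// ltW.
have TR0 : 0 <= 2 * TB * R2 by rewrite mulr_ge0// mulr_ge0// ltW.
(* The summands bound xs, p and e in the invariant region, and y_ij = xs_j + p_j + e_ij. *)
pose rho := X + (1 + 2 * (I0 + 2)) + (1 + 2 * TB * R2).
have rho0 : 0 <= rho by rewrite /rho; move: X0 I00 TR0; lra.
have [L [B [L0 B0 HB HL]]] := partial_box rho.
have [C3 C30 [C4 C40 Hact]] := @action_rate R N k1 k2 M hk2 thetabar m L hN hthetabar m0.
(* Bounds the squared speed of chi while the estimates are in the box and sigma >= 1. *)
pose q2 := \sum_j (B + k1 j / k2 j * M) ^+ 2.
have q20 : 0 <= q2 by apply: sumr_ge0 => j _; exact: sqr_ge0.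
have eps0 : 0 < v2 ^+ 2 / CE by rewrite divr_gt0// exprn_gt0.
(* K converts the squares of w into [Ve], and q2 replaces the squared drift; dividing v2^2 by CE
   anticipates [error_bound]. *)
have [Q Q0 HQ] := @cascade R a b c (C1 * K) m (C2 * q2) C3 C4 I0 (v2 ^+ 2 / CE)
  a0 b0 c0 CK0 m0 (mulr_ge0 C20 q20) C30 C40 I00 eps0.
exists rho, Q; split=> // theta sigma Qth Qsi.
have [s1 [T T0 HT]] := HQ theta sigma Qth Qsi.
exists (t0 + T); first by rewrite lerDl.
move=> G s HG Hs Hs0.
have si0 : 0 < sigma by exact: lt_le_trans s1.
have th0 : 0 < theta by exact: lt_trans Qth.
have [e1 [e2 [p [e red]]]] := reduced_coordinates si0 Hs dd.
pose w i t := e1 i t - k1 i / k2 i * e2 i t.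
pose g i t := G i (row i (est (s t))).
pose q i t := - g i t + k1 i / k2 i * (d' i t / sigma).
pose Ve t := Vobs k1 k2 (e1 ^~ t) (e2 ^~ t).
pose Vn t := Vest thetabar (fun i j => e i j t).
pose Vp t := Vact (p ^~ t).
have tb0 i j : thetabar i j != 0 by rewrite gt_eqF.
pose De t := \sum_i (2 * k2 i * (e1 i t - k1 i / k2 i * e2 i t) *
        (sigma * e2 i t - k1 i / k2 i * (d' i t / sigma)) +
      2 * k2 i * e1 i t * (sigma * (e2 i t - k1 i * e1 i t)) +
      4 * e2 i t * (d' i t / sigma - sigma * k2 i * e1 i t)).
have dVe t : t0 <= t -> is_derive t 1 Ve (De t).
  move=> /red[[de1 de2 _ _] _]; apply: (is_derive_eq (der_Vobs k1 k2 de1 de2)).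
  apply: eq_bigr => i _; congr (_ + _ + _); congr (_ * _).
  by field; rewrite ?gt_eqF.
pose Dn t := \sum_i \sum_j e i j t / thetabar i j * (- (theta * thetabar i j) *
  (\sum_k A i k * (e i j t - e k j t) + A i j * (e i j t - w j t)) - q j t).
have dVn t : t0 <= t -> is_derive t 1 Vn (Dn t).
  by move=> /red[[_ _ _ de] _]; exact: (der_Vest tb0 de).
pose Dp t := \sum_i p i t * q i t.
have dVp t : t0 <= t -> is_derive t 1 Vp (Dp t).
  by move=> /red[[_ _ dp _] _]; exact: (der_Vact dp).
have inbox t : t0 <= t -> Vp t <= I0 + 2 -> Vn t <= R2 ->
    box rho (xs + \row_j p j t) /\ forall i, box rho (row i (est (s t))).
  move=> tt Vpt Vnt.
  have pb j : `|p j t| <= 1 + 2 * (I0 + 2).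
    apply: le_1Dsqr; apply: le_trans (Vact_term (p ^~ t) j) _.
    by rewrite ler_pM2l.
  have eb i j : `|e i j t| <= 1 + 2 * TB * R2.
    apply: le_1Dsqr; apply: le_trans (Vest_term (fun i j => e i j t) i j hthetabar) _.
    rewrite ler_pM ?Vest_ge0// ?mulr_ge0// ?(ltW (hthetabar i j))// ler_pM2l//.
    exact: (HTB (i, j)).
  split=> [j|i j].
    rewrite !mxE (le_trans (ler_normD _ _))//.
    by have := HX j; have := pb j; rewrite /rho; move: TR0; lra.
  have [_ [_ _ Ep Ee]] := red t tt.
  have -> : row i (est (s t)) 0 j = xs 0 j + p j t + e i j t.
    by rewrite mxE Ep Ee -/(w j t); ring.
  apply: le_trans (ler_normD _ _) _; apply: le_trans (lerD (ler_normD _ _) (eb i j)) _.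
  by rewrite /rho lerD2r lerD.
have VnE t : t0 <= t ->
    Vn t = Vest thetabar (fun i j => (est (s t) i j - act (s t) 0 j) + w j t).
  move=> /red[_ [_ _ _ Ee]]; congr (Vest _ _); apply/funext => i; apply/funext => j.
  exact: Ee.
have VpE t : t0 <= t -> Vp t = Vact (fun i => (act (s t) 0 i - xs 0 i) - w i t).
  move=> /red[_ [_ _ Ep _]]; congr Vact; apply/funext => i; exact: Ep.
have HDe t : t0 <= t -> De t <= - (a * sigma) * Ve t + b / sigma ^+ 3.
  by move=> tt; apply: Hobs => // i; exact: dM.
have HDnp t : t0 <= t -> Vp t <= I0 + 2 -> Vn t <= R2 ->
    Dn t <= - (c * theta) * Vn t + C1 * K * theta * Ve t + C2 * q2 / theta /\
    Dp t <= - m * Vp t + C3 * Vn t + C4 / sigma ^+ 2.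
  move=> tt Vpt Vnt; have [bchi best] := inbox t tt Vpt Vnt.
  have gE i : g i t = partial i (f i) (row i (est (s t))) by exact: HG.
  split.
    apply: le_trans (Hest theta (fun i j => e i j t) (w ^~ t) (q ^~ t) th0) _.
    rewrite -!addrA lerD2l; apply: lerD.
      have -> : C1 * K * theta * Ve t = C1 * theta * (K * Ve t) by ring.
      rewrite ler_wpM2l ?(mulr_ge0 C10 (ltW th0))//.
      by have [] := HK (e1 ^~ t) (e2 ^~ t).
    rewrite mulrAC ler_wpM2r ?invr_ge0 ?(ltW th0)// ler_wpM2l//.
    apply: ler_sum => j _; apply: sqr_le_bound.
    rewrite /q (le_trans (ler_normD _ _))// normrN lerD//; first by rewrite gE HB.
    have r0 : 0 < k1 j / k2 j by rewrite divr_gt0.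
    rewrite normrM (gtr0_norm r0) ler_pM2l// normrM normfV (gtr0_norm si0).
    rewrite ler_pdivrMr//; apply: le_trans (dM j t tt) _.
    by rewrite ler_peMr// ltW.
  apply: (Hact sigma (p ^~ t) (fun i j => e i j t) (g ^~ t) (d' ^~ t)) => //.
    by move=> i; exact: dM.
  (* Monotonicity holds at the single point chi = xs + p, whereas player i evaluates at its own row
     y_i. The difference y_i - chi is the i-th row of e, and the Lipschitz constant turns it into
     the term in L. *)
  have := Hmono (\row_j p j t).
  under eq_bigr do rewrite mxE; move=> Hm.
  rewrite lerBlDr; apply: le_trans Hm _.
  rewrite mulr_sumr -big_split; apply: ler_sum => i _ /=; rewrite mxE.
  rewrite -lerBlDl -mulrBr (le_trans (ler_norm _))// normrM -mulr_sumr mulrCA.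
  rewrite ler_wpM2l// gE; apply: le_trans (HL i _ _ bchi (best i)) _.
  rewrite ler_wpM2l//; apply: ler_sum => j _.
  have [_ [_ _ Ep Ee]] := red t tt.
  rewrite !mxE Ep Ee -/(w j t) le_eqVlt -normrN; apply/orP; left; apply/eqP.
  by congr `| _ |; ring.
have [H1 H2 H3 H4] := error_components Hs0.
have [[_ _ _ _] [E1 E2 _ _]] := red t0 (lexx t0).
have [|i|IVe IVn IVp] := Hinit sigma (e1 ^~ t0) (fun i => d i t0 - zhat (s t0) 0 i)
  (fun i => act (s t0) 0 i - xs 0 i) (fun i j => est (s t0) i j - act (s t0) 0 j)
  s1 _ H2 H3 H4 (e2 ^~ t0) (w ^~ t0) E2.
- by move=> i; rewrite E1.
- by [].
rewrite -VnE// in IVn; rewrite -VpE// in IVp.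
have [reg ult] := HT t0 Ve Vn Vp De Dn Dp dVe dVn dVp
  (fun t => Vobs_ge0 k1 _ _ hk2) (fun t => Vest_ge0 _ hthetabar)
  (fun t => Vact_ge0 _) IVe IVn IVp HDe HDnp.
split=> [t tt|t Tt].
  by have [Vpt Vnt] := reg t tt; have [] := inbox t tt Vpt Vnt.
have tt : t0 <= t by apply: le_trans Tt; rewrite lerDl.
apply: norm2_le; first exact: ltW.
rewrite norm2_error; have [_ [F1 F2 _ _]] := red t tt.
apply: (@le_trans _ _ (CE * (sigma ^+ 2 * Ve t + Vn t + Vp t))).
  rewrite (VnE t tt) (VpE t tt).
  have := HCE sigma (e1 ^~ t) (fun i => d i t - zhat (s t) 0 i)
    (fun i => act (s t) 0 i - xs 0 i) (fun i j => est (s t) i j - act (s t) 0 j)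
    (e2 ^~ t) (w ^~ t) s1 F2 (fun i => erefl).
  by under eq_bigr do rewrite F1.
by have := ult t Tt; rewrite ler_pdivlMr// mulrC.
Qed.

End MainEstimate.

(** * Globally Lipschitz fields with additive forcing *)

Section LipschitzFields.
Context {R : realType} {I : finType}.
Implicit Types (g : (I -> R) -> R) (u v : I -> R).

Definition lip g := exists2 L, 0 <= L &
  forall u v, `|g u - g v| <= L * \sum_j `|u j - v j|.

Let S0 u v : 0 <= \sum_j `|u j - v j|.
Proof. by apply: sumr_ge0. Qed.

Lemma lip_coord i : lip (fun u => u i).
Proof.
exists 1 => // u v; rewrite mul1r.
exact: (le_sum_term (a := fun j => `|u j - v j|)).
Qed.

Lemma lipD g1 g2 : lip g1 -> lip g2 -> lip (fun u => g1 u + g2 u).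
Proof.
move=> [L1 L10 H1] [L2 L20 H2]; exists (L1 + L2) => [|u v]; first exact: addr_ge0.
by rewrite opprD addrACA mulrDl (le_trans (ler_normD _ _))// lerD.
Qed.

Lemma lipZ k g : lip g -> lip (fun u => k * g u).
Proof.
move=> [L L0 H]; exists (`|k| * L) => [|u v]; first exact: mulr_ge0.
by rewrite -mulrBr normrM -mulrA ler_wpM2l.
Qed.

Lemma lipN g : lip g -> lip (fun u => - g u).
Proof.
by move=> [L L0 H]; exists L => // u v; rewrite -opprD normrN.
Qed.

Lemma lip_sum (J : finType) (g : J -> (I -> R) -> R) :
  (forall j, lip (g j)) -> lip (fun u => \sum_j g j u).
Proof.
move=> Hg; have /choice[L HL] : forall j, exists L, 0 <= L /\
    forall u v, `|g j u - g j v| <= L * \sum_j `|u j - v j|.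
  by move=> j; have [L ? ?] := Hg j; exists L.
exists (\sum_j L j) => [|u v]; first by apply: sumr_ge0 => j _; exact: (HL j).1.
rewrite -sumrB mulr_suml (le_trans (ler_norm_sum _ _ _))//.
by apply: ler_sum => j _; exact: (HL j).2.
Qed.

Lemma lip_continuous g (u : I -> R -> R) : lip g -> (forall j, continuous (u j)) ->
  continuous (fun t => g (u ^~ t)).
Proof.
move=> [L L0 HL] cu t; apply/cvgrPdist_le => e e0.
pose k := L * #|I|%:R + 1.
have k0 : 0 < k by rewrite ltr_wpDl// mulr_ge0.
have ek : 0 < e / k by rewrite divr_gt0.
have near_all : \forall s \near t, forall j, `|u j t - u j s| <= e / k.
  apply: (filter_forall (nbhs_filter t)) => j.
  by have /cvgrPdist_le := cu j t; apply.
near=> s.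
have H : forall j, `|u j t - u j s| <= e / k by near: s.
apply: le_trans (HL _ _) _.
apply: (@le_trans _ _ (L * \sum_(j : I) e / k)).
  by rewrite ler_wpM2l// ler_sum.
rewrite sumr_const -[_ *+ #|_|]mulr_natl.
have -> : L * (#|I|%:R * (e / k)) = e * (L * #|I|%:R / k) by ring.
rewrite ler_piMr ?(ltW e0)//.
by rewrite ler_pdivrMr// mul1r /k lerDl.
Unshelve. all: by end_near.
Qed.

(** The loop is an autonomous field plus the disturbance as forcing, so time dependence enters
    through h alone and the growth condition reduces to one on h. *)
Lemma picard_additive (t0 M : R) (g : I -> (I -> R) -> R) (h : I -> R -> R) (u0 : I -> R) :
  (forall i, lip (g i)) -> (forall i, continuous (h i)) -> 0 <= M ->
  (forall i t, t0 <= t -> `|h i t| <= M * expR (t - t0)) ->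
  exists u : I -> R -> R, (forall i, u i t0 = u0 i) /\
    forall t, t0 <= t -> forall i, is_derive t 1 (u i) (g i (u ^~ t) + h i t).
Proof.
move=> Hg ch M0 hM.
have /choice[Lf HLf] : forall i, exists L, 0 <= L /\
    forall u v, `|g i u - g i v| <= L * \sum_j `|u j - v j|.
  by move=> i; have [L ? ?] := Hg i; exists L.
have [L L0 HL] := finite_ub Lf.
have [B B0 HB] := finite_ub (fun i => `|g i u0|).
apply: (@global_picard R I t0 L (B + M) (fun t u i => g i u + h i t) u0) => //.
- exact: ltW.
- by rewrite addr_ge0// ltW.
- move=> t u v i _; rewrite opprD addrACA subrr addr0.
  by apply: le_trans ((HLf i).2 u v) _; rewrite ler_wpM2r.
- move=> u cu i t; apply: cvgD; last exact: ch.
  by have := lip_continuous (Hg i) cu; apply.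
- move=> t i tt; rewrite mulrDl (le_trans (ler_normD _ _))// lerD ?hM//.
  apply: le_trans (HB i) _; rewrite ler_peMr ?(ltW B0)//.
  by rewrite -expR0 ler_expR subr_ge0.
Qed.

End LipschitzFields.

(** * Solutions of the truncated loop *)

Section Existence.
Context {R : realType} {N : nat}.
Variables (f : 'I_N -> 'rV[R]_N -> R) (A : 'M[R]_N) (t0 : R) (d : 'I_N -> R -> R).
Variables (thetabar : 'M[R]_N) (k1 k2 : 'I_N -> R).
Hypotheses (hf : forall i, C2 (f i)) (hd : forall i, C1_bounded_from t0 (d i)).

(** A bounded derivative allows growth that the exponential dominates. Freezing [d i] before t0 is
    essential: its values there are arbitrary, while the forcing must be continuous on the whole
    line. *)
Lemma disturbance_growth : exists2 M, 0 <= M & forall i,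
  continuous (fun t => d i (Num.max t t0)) /\
  forall t, t0 <= t -> `|d i (Num.max t t0)| <= M * expR (t - t0).
Proof.
have [d' [M [M0 dd dM]]] := disturbance_bound hd.
have [B B0 HB] := finite_ub (fun i => `|d i t0|).
exists (B + M) => [|i]; first by rewrite addr_ge0// ltW.
have [D [DE dD]] := deriv_from_extension (dd i); split=> [t|t tt].
  have -> : (fun t => d i (Num.max t t0)) = D \o (fun t => Num.max t t0).
    by apply/funext => s /=; rewrite DE// le_max lexx orbT.
  apply: continuous_comp; first exact: continuous_clamp.
  by apply: der_cont (dD _ _); rewrite le_max lexx orbT.
have e1 s : t0 <= s -> 1 <= expR (s - t0).
  by move=> st; rewrite -expR0 ler_expR subr_ge0.
have := @exp_growth R D (d' i) t0 t M 1 tt (ltW M0).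
move=> /(_ (fun s st => dD s (andP st).1)) H.
have {}H : `|D t - D t0| <= M * expR (1 * (t - t0)).
  apply: H => s /andP[st _]; rewrite !mul1r; apply: le_trans (dM i s st) _.
  by rewrite ler_peMr ?(ltW M0)// e1.
rewrite max_l// mulrDl -(subrK (d i t0) (d i t)) addrC.
rewrite (le_trans (ler_normD _ _))// lerD//.
  by apply: le_trans (HB i) _; rewrite ler_peMr ?(ltW B0)// e1.
by rewrite mul1r DE// DE in H.
Qed.

Lemma truncated_solution (rho theta sigma : R) (s0 : state R N) : 0 <= rho ->
  exists s : R -> state R N,
    loop_for A t0 d thetabar k1 k2 (fun i x => partial i (f i) (clamp rho x))
      theta sigma s /\ s t0 = s0.
Proof.
move=> rho0.
(* The four blocks of the state become one family of reals indexed by a finite sum type, as the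
   Picard theorem expects. *)
pose I : finType := ('I_N + 'I_N * 'I_N + ('I_N + 'I_N))%type.
pose X i : I := inl (inl i); pose Y i j : I := inl (inr (i, j)).
pose Xh i : I := inr (inl i); pose Zh i : I := inr (inr i).
pose st (u : I -> R) : state R N := State (\row_i u (X i)) (\matrix_(i, j) u (Y i j))
  (\row_i u (Xh i)) (\row_i u (Zh i)).
pose G i x := partial i (f i) (clamp rho x).
pose v (u : I -> R) i := - G i (row i (est (st u))) - zhat (st u) 0 i.
pose g (i : I) (u : I -> R) := match i with
  | inl (inl i) => v u i
  | inl (inr (i, j)) => - (theta * thetabar i j) * consensus_error A (st u) i j
  | inr (inl i) => v u i + zhat (st u) 0 i
                   + sigma * k1 i * (act (st u) 0 i - xhat (st u) 0 i)
  | inr (inr i) => sigma ^+ 2 * k2 i * (act (st u) 0 i - xhat (st u) 0 i)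
  end.
pose h (i : I) t := match i with inl (inl i) => d i (Num.max t t0) | _ => 0 end.
pose u0 (i : I) := match i with
  | inl (inl i) => act s0 0 i | inl (inr (i, j)) => est s0 i j
  | inr (inl i) => xhat s0 0 i | inr (inr i) => zhat s0 0 i end.
have lipX i : lip (fun u : I -> R => act (st u) 0 i).
  have [L ? H] := lip_coord (R := R) (X i); exists L => // u w.
  by rewrite !mxE.
have lipY i j : lip (fun u : I -> R => est (st u) i j).
  have [L ? H] := lip_coord (R := R) (Y i j); exists L => // u w.
  by rewrite !mxE.
have lipXh i : lip (fun u : I -> R => xhat (st u) 0 i).
  have [L ? H] := lip_coord (R := R) (Xh i); exists L => // u w.
  by rewrite !mxE.
have lipZh i : lip (fun u : I -> R => zhat (st u) 0 i).
  have [L ? H] := lip_coord (R := R) (Zh i); exists L => // u w.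
  by rewrite !mxE.
(* The Lipschitz bound on the box becomes global because [clamp] maps into the box without
   increasing coordinate distances. *)
have lipG i : lip (fun u => G i (row i (est (st u)))).
  have [L [L0 HL]] := lipschitz_box rho ((hf i).2 i).
  exists (L * N%:R) => [|u w]; first by rewrite mulr_ge0.
  apply: le_trans (HL _ _ (clamp_box _ rho0) (clamp_box _ rho0)) _.
  rewrite -mulrA ler_wpM2l//.
  have -> : N%:R * \sum_j `|u j - w j| = \sum_(k < N) \sum_j `|u j - w j|.
    by rewrite sumr_const card_ord mulr_natl.
  apply: ler_sum => k _; apply: le_trans (clamp_lip _ _ _ _) _; rewrite !mxE.
  exact: (le_sum_term (a := fun j => `|u j - w j|) (Y i k)).
have lipv i : lip (v ^~ i) by apply: lipD; apply: lipN.
have lipB g1 g2 : lip g1 -> lip g2 -> lip (fun u : I -> R => g1 u - g2 u).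
  by move=> H1 H2; apply: lipD => //; exact: lipN.
have lipg i : lip (g i).
  case: i => [[i|[i j]]|[i|i]] /=.
  - exact: lipv.
  - apply: lipZ; apply: lipD.
      by apply: lip_sum => k; apply: lipZ; exact: lipB.
    by apply: lipZ; exact: lipB.
  - by apply: lipD; [exact: lipD|apply: lipZ; exact: lipB].
  - by apply: lipZ; exact: lipB.
have [M M0 HM] := disturbance_growth.
have ch i : continuous (h i).
  case: i => [[i|[i j]]|[i|i]] /=; try (by move=> t; exact: cvg_cst).
  exact: (HM i).1.
have hM i t : t0 <= t -> `|h i t| <= M * expR (t - t0).
  have ? : 0 <= M * expR (t - t0) by rewrite mulr_ge0// expR_ge0.
  by case: i => [[i|[i j]]|[i|i]] /=; rewrite ?normr0//; exact: (HM i).2.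
have [u [ut0 du]] := @picard_additive R I t0 M g h u0 lipg ch M0 hM.
exists (fun t => st (u ^~ t)); split=> [t tt|].
  split=> [i|i j|i|i].
  - have -> : (fun r => act (st (u ^~ r)) 0 i) = u (X i) by apply/funext => r; rewrite mxE.
    have := du t tt (X i); rewrite /g /h /= max_l//; exact: is_derive_deriv_from.
  - have -> : (fun r => est (st (u ^~ r)) i j) = u (Y i j) by apply/funext => r; rewrite mxE.
    have := du t tt (Y i j); rewrite /g /h /= addr0; exact: is_derive_deriv_from.
  - have -> : (fun r => xhat (st (u ^~ r)) 0 i) = u (Xh i) by apply/funext => r; rewrite mxE.
    have := du t tt (Xh i); rewrite /g /h /= addr0; exact: is_derive_deriv_from.
  - have -> : (fun r => zhat (st (u ^~ r)) 0 i) = u (Zh i) by apply/funext => r; rewrite mxE.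
    have := du t tt (Zh i); rewrite /g /h /= addr0; exact: is_derive_deriv_from.
have -> : u ^~ t0 = u0 by apply/funext => i; exact: ut0.
transitivity (State (act s0) (est s0) (xhat s0) (zhat s0)); last by case: (s0).
by congr State; [apply/rowP => i|apply/matrixP => i j|apply/rowP => i|apply/rowP => i];
  rewrite mxE.
Qed.

End Existence.

Theorem theorem1 (R : realType) (N : nat) (hN : (2 <= N)%N)
  (f : 'I_N -> 'rV[R]_N -> R) (A : 'M[R]_N)
  (t0 : R) (d : 'I_N -> R -> R)
  (thetabar : 'M[R]_N) (k1 k2 : 'I_N -> R)
  (hthetabar : forall i j, 0 < thetabar i j)
  (hk1 : forall i, 0 < k1 i) (hk2 : forall i, 0 < k2 i)
  (hf : forall i, C2 (f i))
  (hmono : strongly_monotone (pseudogradient f))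
  (hA : is_adjacency A) (hundirected : undirected A)
  (hconnected : connected_graph A)
  (hd : forall i, C1_bounded_from t0 (d i))
  (xs : 'rV[R]_N) (hxs : nash_equilibrium f xs) :
  forall v1 v2 : R, 0 < v1 -> 0 < v2 ->
  exists theta_star sigma_star : R,
    [/\ 0 < theta_star, 0 < sigma_star
      & forall theta sigma : R, theta_star < theta -> sigma_star < sigma ->
        exists T : R, t0 <= T /\
          forall s0 : state R N, norm2 (error d xs t0 s0) <= v1 ->
            (exists s : R -> state R N,
               closed_loop f A d thetabar k1 k2 t0 theta sigma s /\ s t0 = s0) /\
            (forall s : R -> state R N,
               closed_loop f A d thetabar k1 k2 t0 theta sigma s -> s t0 = s0 ->
               forall t, T <= t -> norm2 (error d xs t (s t)) <= v2)].
Proof.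
move=> v1 v2 v10 v20.
have [rho [Q [rho0 Q0 HQ]]] := main_estimate hN hthetabar hk1 hk2 hf hmono
  hA hundirected hconnected hd hxs v10 v20.
exists Q, Q; split=> // theta sigma Qth Qsi.
have [T t0T HT] := HQ theta sigma Qth Qsi.
exists T; split=> // s0 Hs0; split=> [|s Hs st0 t Tt]; last first.
  (* For a given solution the feedback is the family of partial derivatives itself, and agreement on
     the box is trivial. *)
  by apply: (HT (fun i => partial i (f i)) s _ Hs _).2 => //; rewrite st0.
have [s [Hs st0]] := truncated_solution A thetabar k1 k2 hf hd theta sigma s0 rho0.
exists s; split=> [t tt|]; last exact: st0.
(* Agreement on the box makes the main estimate available for the truncated loop; it keeps the
   estimates in the box, where the truncation is inactive, so s solves the original loop. *)
have agree i x : box rho x -> partial i (f i) (clamp rho x) = partial i (f i) x.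
  by move=> bx; rewrite clamp_id.
rewrite -st0 in Hs0; have [inbox _] := HT _ s agree Hs Hs0.
have := Hs t tt; have E i : clamp rho (row i (est (s t))) = row i (est (s t)).
  by rewrite clamp_id//; exact: inbox.
by move=> [H1 H2 H3 H4]; split=> // i; rewrite /control -[row i _]E; [exact: H1|exact: H3].
Qed.
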